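(* Let $N\ge 1$ be an integer, let $s\in\mathbb C$, and let $\mathbf r=(r_1,\dots,r_N)\in\mathbb C^N$ satisfy $\sum_{i=1}^N r_i-\frac{N-1}{2}=s$. Let $W_{1+\infty}$ act on $\mathbb C[[t_1,t_2,\dots]]$ via the representation with central charge $N$ attached to $(s,N)$ (described in the context), let $\tau_{\mathbf r}$ be the tau-function of the Bessel plane $W_{\mathbf r}$, and let $\mathcal M_{\mathbf r}$ be the $W_{1+\infty}$-submodule generated by $\tau_{\mathbf r}$. Then: (i) $\tau_{\mathbf r}$ is a highest weight vector: for all $l\ge 0$, $$L^l_k\,\tau_{\mathbf r}=0\quad\text{for all } k>0,\qquad L^l_0\,\tau_{\mathbf r}=\lambda_{\mathbf r}(L^l_0)\,\tau_{\mathbf r},$$ for some scalars $\lambda_{\mathbf r}(L^l_0)\in\mathbb C$. As $\mathbf r$ varies over $\mathbb C^N$ (with $s=\sum_i r_i-\frac{N-1}{2}$), each $\lambda_{\mathbf r}(L^l_0)$ is given by a symmetric polynomial in $r_1,\dots,r_N$; for example $$\lambda_{\mathbf r}(L^0_0)=\sum_{i=1}^N r_i,\qquad \lambda_{\mathbf r}(L^1_0)=\frac12\sum_{i=1}^N r_i^2-\frac12\sum_{i=1}^N r_i .$$ (ii) The module $\mathcal M_{\mathbf r}$ is quasifinite, with characteristic polynomials $$P_{\mathbf r,k}(D)=P_{\mathbf r}(D)\,P_{\mathbf r}(D-1)\cdots P_{\mathbf r}(D-k+1),\qquad k\in\mathbb N=\{1,2,\dots\},$$ where $P_{\mathbf r}(D)=(D-r_1)(D-r_2)\cdots(D-r_N)$.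 That is, for every $k\ge1$, $$W\bigl(z^{-k}P_{\mathbf r,k}(D_z)\bigr)\,\tau_{\mathbf r}=0,$$ and $P_{\mathbf r,k}$ has minimal degree among the nonzero polynomials $b$ with $W(z^{-k}b(D_z))\tau_{\mathbf r}=0$.
   Context: **The algebra.** $\mathcal D=\mathbb C[z,z^{-1}][\partial_z]$ is the Lie algebra of regular differential operators on the circle, and $D=D_z=z\partial_z$. $W_{1+\infty}=\{W(A):A\in\mathcal D\}\oplus\mathbb Cc$, with $A\mapsto W(A)$ linear and injective, is its central extension with $c$ central and (as generating series in $x,y$) $$[W(z^ke^{xD}),W(z^me^{yD})]=(e^{xm}-e^{yk})W(z^{k+m}e^{(x+y)D})+\delta_{k,-m}\frac{e^{xm}-e^{yk}}{1-e^{x+y}}\,c .$$ For $k\in\mathbb Z$, $l\ge0$ put $L^l_k=W(-z^kD_z^l)$. **Fock space.** $V=\bigoplus_{j\in\mathbb Z}\mathbb Cv_j$. $F^{(0)}$ is the span of the semi-infinite monomials $v_{i_0}\wedge v_{i_1}\wedge\cdots$ with $i_0>i_1>\cdots$ and $i_k=-k$ for $k\gg0$; $\widetilde F^{(0)}$ is its formal completion (arbitrary formal linear combinations of these monomials); $|0\rangle=v_0\wedge v_{-1}\wedge v_{-2}\wedge\cdots$. The matrix unit $E_{ij}$ ($E_{ij}v_k=\delta_{jk}v_i$) acts on $F^{(0)}$ as a derivation of the wedge product; call this $r(E_{ij})$. Set $\hat r(E_{ij})=r(E_{ij})-\delta_{ij}$ if $j\le 0$, and $\hat r(E_{ij})=r(E_{ij})$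 if $j>0$. Then $\hat r$ extends linearly to all $\mathbb Z\times\mathbb Z$ matrices with finitely many nonzero diagonals, acting on $F^{(0)}$ and on $\widetilde F^{(0)}$. **The representation attached to $(s,N)$.** Put $z=\zeta^N$, so $D_z=\frac1N\zeta\partial_\zeta$, and identify $v_k=e^{N\zeta}\zeta^{s-k}$, $k\in\mathbb Z$. Each $A\in\mathcal D$ then acts on $V$ by a matrix with finitely many nonzero diagonals (e.g. $zv_k=v_{k-N}$, $D_zv_k=v_{k-1}+\frac{s-k}{N}v_k$), again denoted $A$. The representation is $c\mapsto N$, $W(A)\mapsto\hat r(A)+\gamma(A)\,\mathrm{Id}$, where $\gamma:\mathcal D\to\mathbb C$ is the unique linear functional making this a Lie algebra representation of $W_{1+\infty}$. Explicitly $\gamma(z^ke^{xD_z})=0$ for $k>0$ and $$\gamma(e^{xD_z})=\frac{1}{1-e^{x/N}}-\frac{N}{1-e^x}+\frac{e^{sx/N}-1}{1-e^{x/N}};$$ for $k<0$, $\gamma(z^kf(D_z))$ is determined by $W(z^kf(D_z))=\frac1k[W(D_z),W(z^kf(D_z))]$. **Boson–fermion correspondence.** Let $J_n=-\hat r(\zeta^n)$, where $\zeta^n$ denotes the matrix $v_k\mapsto v_{k-n}$. Let $\sigma:F^{(0)}\to\mathbb C[t_1,t_2,\dots]$ be the unique linear isomorphism with $\sigma(|0\rangle)=1$ under which $J_n$ corresponds to $\partial/\partial t_n$ and $J_{-n}$ to multiplication by $nt_n$ ($n>0$). It extends to $\widetilde F^{(0)}\to\mathbb C[[t_1,t_2,\dots]]$,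 and $W_{1+\infty}$ acts on $\mathbb C[[t_1,t_2,\dots]]$ via $\sigma$. **Bessel plane and tau-function.** For $\mathbf r\in\mathbb C^N$ with $s(\mathbf r):=\sum_i r_i-\frac{N-1}2=s$, there is a unique formal series $\Psi_{\mathbf r}(\zeta)=\zeta^{s}e^{N\zeta}\bigl(1+\sum_{i\ge1}a_i(\mathbf r)\zeta^{-i}\bigr)=v_0+\sum_{i\ge1}a_i(\mathbf r)v_i$ with $P_{\mathbf r}(D_z)\Psi_{\mathbf r}=z\Psi_{\mathbf r}$. The Bessel plane $W_{\mathbf r}$ is the space spanned by $D_z^k\Psi_{\mathbf r}$, $k\ge0$; it has a basis of the form $w_{-k}=v_{-k}+\sum_{i>-k}w_{i,-k}v_i$, $k=0,1,2,\dots$. Its tau-function is $\tau_{\mathbf r}=\sigma(w_0\wedge w_{-1}\wedge w_{-2}\wedge\cdots)\in\mathbb C[[t_1,t_2,\dots]]$ (independent of the choice of such a basis). **Module and quasifiniteness.** $\mathcal M_{\mathbf r}=U(W_{1+\infty})\tau_{\mathbf r}$. It is graded by the levels $d\ge0$, where level $d$ is spanned by all $W(z^{-k_1}f_1(D_z))\cdots W(z^{-k_m}f_m(D_z))\tau_{\mathbf r}$ with $m\ge 0$, $k_i\ge1$, $\sum k_i=d$ and $f_i$ polynomials. ''Quasifinite'' means that every level is finite-dimensional. *)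

(* Defs.v *)
(* Everything is defined over an arbitrary field K; the intended instance is the
   field of complex numbers R[i], R : realType. *)
From HB Require Import structures.
From mathcomp Require Import all_boot all_order all_algebra finmap.
From mathcomp Require Import boolp classical_sets functions cardinality fsbigop.
From mathcomp Require Import reals complex.
From mathcomp Require Import mpoly.

Set Implicit Arguments.
Unset Strict Implicit.
Unset Printing Implicit Defensive.

Import Order.TTheory GRing.Theory Num.Theory.
Local Open Scope classical_set_scope.
Local Open Scope ring_scope.

Section LinearAlgebra.
Variables (K : fieldType) (V : lmodType K).

Definition lspan (S : set V) : set V :=
  [set v | exists (n : nat) (c : 'I_n -> K) (x : 'I_n -> V),
     (forall i, S (x i)) /\ v = \sum_(i < n) c i *: x i].

Definition findim (U : set V) : Prop :=
  exists (n : nat) (x : 'I_n -> V), U = lspan (range x).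

(* M is the direct sum of the subspaces L d. *)
Definition graded_by (M : set V) (L : nat -> set V) : Prop :=
  M = lspan (\bigcup_d L d) /\
  (forall (n : nat) (x : 'I_n -> V),
     (forall d : 'I_n, L d (x d)) -> \sum_(d < n) x d = 0 -> forall d, x d = 0).

End LinearAlgebra.

(* A semi-infinite monomial v_{i_0} /\ v_{i_1} /\ ... with i_0 > i_1 > ... and
   i_k = -k for k >> 0 is encoded by the partition (i_k + k)_k, listed without
   its trailing zeros. *)
Definition is_partition (s : seq nat) : bool :=
  sorted geq s && (0%N \notin s).

Record smon := Smon { parts :> seq nat; _ : is_partition parts }.
HB.instance Definition _ := [isSub for parts].
HB.instance Definition _ := [Countable of smon by <:].

Definition smon_ix (m : smon) (k : nat) : int := (nth 0%N m k)%:Z - k%:Z.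

Definition smon_vac : smon := @Smon [::] isT.

Section Fock.
Variable K : fieldType.

(* Formal combinations of the v_i; the elements of V are those of finite
   support. *)
Definition vect := int -> K^o.

(* The completion of F^(0): arbitrary formal combinations of monomials.  F^(0)
   itself consists of the elements of finite support. *)
Definition fock := smon -> K^o.

Definition finsupported (T : choiceType) (f : T -> K^o) : Prop :=
  finite_set [set x | f x != 0].

Definition vdelta (j : int) : vect := fun i => (i == j)%:R.

Definition ket (m : smon) : fock := fun m' => (m' == m)%:R.

(* The coefficient of the monomial m in u_0 /\ u_1 /\ ..., computed as the minor
   of size n.  The infinite matrix of the components of the u_b on the factors of
   m must be block triangular, with a unitriangular tail, beyond its first n rows
   and columns; this holds in the two uses below. *)
Definition wedge_minor (n : nat) (u : nat -> vect) (m : smon) : K :=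
  \det (\matrix_(a < n, b < n) (u b (smon_ix m a) : K)).

(* w_0 /\ w_{-1} /\ ..., where w k stands for w_{-k} = v_{-k} + (terms v_i with
   i > -k). *)
Definition wedge (w : nat -> vect) : fock := fun m => wedge_minor (size m) w m.

Definition unit_act (i j : int) (f : vect) : vect := fun x => vdelta i x * f j.

(* The coefficient of the monomial m in r(E_ij) m0.  Only the factor of m0 equal
   to v_j contributes to the derivation, and its position is less than the
   bound n below. *)
Definition r_unit (i j : int) (m m0 : smon) : K :=
  let n := (size m + size m0 + `|j| .+1)%N in
  \sum_(k < n)
    wedge_minor n
      (fun b => if b == k :> nat then unit_act i j (vdelta (smon_ix m0 k))
                else vdelta (smon_ix m0 b)) m.

Definition rhat_unit (i j : int) (m m0 : smon) : K :=
  r_unit i j m m0 - (if (i == j) && (j <= 0) then (m == m0)%:R else 0).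

(* A matrix (A_ij) with A v_j = sum_i A_ij v_i is given as a function of i and
   j.  If A has finitely many nonzero diagonals, both sums have finite
   support. *)
Definition rhat (A : int -> int -> K) (v : fock) : fock := fun m =>
  \sum_(m0 \in [set: smon])
    (\sum_(p \in [set: int * int]) (A p.1 p.2 * rhat_unit p.1 p.2 m m0)) * v m0.

End Fock.

Section FormalSeries.
Variable K : fieldType.

(* The formal power series sum_n (f n) x^n. *)
Definition fps := nat -> K.

Definition fps_mul (f g : fps) : fps := fun n => \sum_(i < n.+1) f i * g (n - i)%N.
Definition fps_one : fps := fun n => (n == 0%N)%:R.
Definition fps_exp (a : K) : fps := fun n => a ^+ n / n`!%:R.

(* The inverse of a series with constant term 1, as a geometric series. *)
Definition fps_inv1 (f : fps) : fps := fun n =>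
  \sum_(j < n.+1) iter j (fps_mul (fun i => fps_one i - f i)) fps_one n.

(* x / (1 - e^(a x)), using 1 - e^(a x) = - a x * sum_n a^n x^n / (n+1)! *)
Definition fps_x_div_1_sub_exp (a : K) : fps := fun n =>
  - a^-1 * fps_inv1 (fun i => a ^+ i / i.+1`!%:R) n.

End FormalSeries.

Section Representation.
Variables (K : fieldType) (N : nat) (s : K).

Definition zact (k : int) (f : vect K) : vect K := fun i => f (i + k * N%:Z).

(* D_z v_k = v_{k-1} + (s-k)/N v_k *)
Definition Dact (f : vect K) : vect K := fun i =>
  f (i + 1) + (s - i%:~R) / N%:R * f i.

(* The differential operator z^k p(D_z).  These span all differential
   operators, so that W below determines the action of W_{1+oo}. *)
Definition diffop (k : int) (p : {poly K}) (f : vect K) : vect K :=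
  zact k (\sum_(l < size p) p`_l *: iter l Dact f).

Definition diffop_mx (k : int) (p : {poly K}) : int -> int -> K :=
  fun i j => diffop k p (vdelta K j) i.

Definition rhat_op (k : int) (p : {poly K}) : fock K -> fock K :=
  rhat (diffop_mx k p).

(* x * (1/(1-e^(x/N)) - N/(1-e^x) + (e^(sx/N)-1)/(1-e^(x/N))) *)
Definition x_gamma_series : fps K := fun n =>
  fps_x_div_1_sub_exp N%:R^-1 n
  - N%:R * fps_x_div_1_sub_exp 1 n
  + fps_mul (fun i => fps_exp (s / N%:R) i - fps_one K i)
            (fps_x_div_1_sub_exp N%:R^-1) n.

Definition gamma_D (l : nat) : K := l`!%:R * x_gamma_series l.+1.

(* For k < 0, W(z^k p(D)) = (1/k) [W(D), W(z^k p(D))] = (1/k) [rhat(D),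
   rhat(z^k p(D))], because W and rhat differ by scalars; the scalar gamma is
   read off on the vacuum. *)
Definition gamma (k : int) (p : {poly K}) : K :=
  if 0 < k then 0
  else if k == 0 then \sum_(l < size p) p`_l * gamma_D l
  else
    (k%:~R^-1 *: (rhat_op 0 'X (rhat_op k p (ket K smon_vac))
                  - rhat_op k p (rhat_op 0 'X (ket K smon_vac)))
     - rhat_op k p (ket K smon_vac)) smon_vac.

(* W(z^k p(D_z)) on the completed Fock space. *)
Definition W_fock (k : int) (p : {poly K}) (v : fock K) : fock K :=
  rhat_op k p v + gamma k p *: v.

End Representation.

Section BosonFermion.
Variable K : fieldType.

(* The monomial prod_n t_{n+1}^(e n).  The 0-based n stands for the variable
   t_{n+1} throughout. *)
Definition tmon := {fsfun nat -> nat with 0%N}.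

(* C[[t_1, t_2, ...]]; C[t_1, t_2, ...] consists of the series of finite
   support. *)
Definition tseries := tmon -> K^o.

Definition tone : tseries := fun e => (e == [fsfun])%:R.

Definition tder (n : nat) (f : tseries) : tseries := fun e =>
  (e n).+1%:R * f [fsfun e with n |-> (e n).+1].

Definition tmul (n : nat) (f : tseries) : tseries := fun e =>
  if e n is d.+1 then f [fsfun e with n |-> d] else 0.

(* J_n = - rhat(zeta^n), where zeta^n v_j = v_{j-n} *)
Definition J (n : int) (v : fock K) : fock K :=
  - rhat (fun i j => (i == j - n)%:R) v.

(* sigma is the boson-fermion correspondence, extended to the completions, and
   sigma' is its inverse. *)
Definition boson_fermion (sigma : fock K -> tseries) (sigma' : tseries -> fock K)
  : Prop :=
  [/\ linear sigma, cancel sigma sigma' & cancel sigma' sigma] /\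
  (* sigma maps F^(0) onto C[t_1, t_2, ...] *)
  (forall v, finsupported v <-> finsupported (sigma v)) /\
  (* sigma is the extension of its restriction to F^(0) *)
  (forall e, finite_set [set m | sigma (ket K m) e != 0] /\
     forall v, sigma v e = \sum_(m \in [set: smon]) v m * sigma (ket K m) e) /\
  sigma (ket K smon_vac) = tone /\
  (forall n v, finsupported v ->
     sigma (J n.+1%:Z v) = tder n (sigma v) /\
     sigma (J (- n.+1%:Z) v) = n.+1%:R *: tmul n (sigma v)).

End BosonFermion.

Section BesselPlane.
Variables (K : fieldType) (N : nat) (r : 'I_N -> K).

Definition bessel_poly : {poly K} := \prod_(i < N) ('X - (r i)%:P).

Definition wchar_poly (k : nat) : {poly K} :=
  \prod_(j < k) (bessel_poly \Po ('X - (j%:R)%:P)).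

Definition bessel_s : K := \sum_(i < N) r i - (N%:R - 1) / 2%:R.

Definition is_bessel_wave (s : K) (Psi : vect K) : Prop :=
  [/\ Psi 0 = 1, (forall i : int, i < 0 -> Psi i = 0) &
      diffop N s 0 bessel_poly Psi = zact N 1 Psi].

Definition bessel_plane (s : K) (Psi : vect K) : set (vect K) :=
  lspan (range (fun k => iter k (Dact N s) Psi)).

(* w k stands for w_{-k}; linear independence is automatic. *)
Definition admissible_basis (U : set (vect K)) (w : nat -> vect K) : Prop :=
  (forall k : nat, w k (- k%:Z) = 1 /\ forall i : int, i < - k%:Z -> w k i = 0)
  /\ lspan (range w) = U.

Definition is_tau (sigma : fock K -> tseries K) (tau : tseries K) : Prop :=
  exists (Psi : vect K) (w : nat -> vect K),
    [/\ is_bessel_wave bessel_s Psi,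
        admissible_basis (bessel_plane bessel_s Psi) w & tau = sigma (wedge w)].

End BesselPlane.

Section Module.
Variables (K : fieldType) (N : nat) (s : K).
Variables (sigma : fock K -> tseries K) (sigma' : tseries K -> fock K).

(* The operator W(z^k p(D_z)) on C[[t_1, t_2, ...]]. *)
Definition W (k : int) (p : {poly K}) (f : tseries K) : tseries K :=
  sigma (W_fock N s k p (sigma' f)).

(* L^l_k *)
Definition Lop (l : nat) (k : int) : tseries K -> tseries K := W k (- 'X^l).

(* The central element acts by the scalar N. *)
Definition W_submodule (M : set (tseries K)) : Prop :=
  [/\ M 0, (forall (a : K) u v, M u -> M v -> M (a *: u + v)),
      (forall k p u, M u -> M (W k p u)) & (forall u, M u -> M (N%:R *: u))].

(* U(W_{1+oo}) tau *)
Definition W_generated (tau : tseries K) : set (tseries K) :=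
  smallest W_submodule [set tau].

Definition W_word (q : seq (nat * {poly K})) (tau : tseries K) : tseries K :=
  foldr (fun kf => W (- kf.1%:Z) kf.2) tau q.

Definition level (tau : tseries K) (d : nat) : set (tseries K) :=
  lspan [set u | exists q : seq (nat * {poly K}),
    [/\ all (fun kf => 0 < kf.1)%N q, sumn (map fst q) = d & u = W_word q tau]].

(* The module generated by tau is the direct sum of its levels, each of which is
   finite-dimensional. *)
Definition quasifinite (tau : tseries K) : Prop :=
  graded_by (W_generated tau) (level tau) /\ forall d, findim (level tau d).

End Module.

(* Main.v *)
(* If an operator A preserves the span of w_0, w_{-1}, ..., then rhat(A) multiplies
   tau = w_0 /\ w_{-1} /\ ... by a scalar, the regularized trace of A, as one sees on
   minors when w is in reduced echelon form.  The Bessel plane is K[D] Psi, and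
   P(D) Psi = z Psi gives P_k(D) Psi = z^k Psi; so it is preserved by z^k p(D) for
   k >= 0 and by z^(-k) P_k(D) p(D).  Since [W(D), W(z^k p)] = k W(z^k p), the scalar
   is 0 unless k = 0.  If deg b < deg P_k, then z^(-k) b(D) strictly raises
   indices, so rhat of it maps tau to a vector without vacuum component, which still
   has a nonzero component on a one-row monomial.  Quasifiniteness: if u
   is killed by all W(z^(-k) b g), with b depending on u and k, then so is
   W(z^(-j) h) u, for another b.  The scalar on W(D^l) is a polynomial in the
   coordinates of the reduced basis, and these are polynomials in the coefficients
   of P by the recursion for Psi. *)
Require Import Defs.
From HB Require Import structures.
From mathcomp Require Import all_boot all_order all_algebra finmap.
From mathcomp Require Import perm.
From mathcomp Require Import boolp classical_sets functions cardinality fsbigop.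
From mathcomp Require Import reals complex.
From mathcomp Require Import mpoly.
From mathcomp Require Import zify ring.

Set Implicit Arguments.
Unset Strict Implicit.
Unset Printing Implicit Defensive.

Import Order.TTheory GRing.Theory Num.Theory.
Local Open Scope classical_set_scope.
Local Open Scope ring_scope.

(** * Semi-infinite monomials *)

Section Monomials.
Implicit Type m : smon.

(** Vectors of the completed Fock space have infinitely many coefficients, so [rhat A (rhat B v)]
    cannot be expanded monomial by monomial over [v]. What is finite is the way back: for a banded
    [A] one coefficient of [rhat A v] involves finitely many coefficients of [v], obtained by moving
    the indices of the monomial that is read off. To iterate this, the coefficients are extended to
    alternating functions of index tuples, and matrices are cut to a finite window; composing
    derivations then becomes ordinary algebra of one-body operators, with errors only at the lower
    edge of the window, among filled positions. The cocycle is never computed. Commutators are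
    needed only up to some scalar, and comparison with [W(D)] removes the scalar for two operators
    of negative degree. Of the weights only two are computed: the regularized trace of [D] is the
    single coefficient [Psi 1], and [gamma] contributes its first two values on powers of [D]. *)

Lemma smon_ix_tail m a : (size m <= a)%N -> smon_ix m a = - a%:Z.
Proof. by move=> h; rewrite /smon_ix nth_default // sub0r. Qed.

Lemma smon_nth_pos m a : (a < size m)%N -> (0 < nth 0%N m a)%N.
Proof.
case: m => s /= /andP[_ h0] ha; rewrite lt0n; apply: contraNneq h0 => <-.
exact: mem_nth.
Qed.

Lemma smon_nth_le m a b : (a <= b)%N -> (nth 0 m b <= nth 0 m a)%N.
Proof.
move=> ab; case: (ltnP b (size m)) => hb; last by rewrite nth_default.
case: m hb => s /= /andP[hs _] hb.
have tr : transitive geq by move=> x y z /= h1 h2; exact: leq_trans h2 h1.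
by apply: (sorted_leq_nth tr leqnn 0%N hs) => //; rewrite unfold_in /=; lia.
Qed.

Lemma smon_ix_lt m a b : (a < b)%N -> smon_ix m b < smon_ix m a.
Proof. by move=> ab; rewrite /smon_ix; have := @smon_nth_le m _ _ (ltnW ab); lia. Qed.

Lemma smon_ix_inj m : injective (smon_ix m).
Proof.
move=> a b e; case: (ltngtP a b) => // h; have := smon_ix_lt m h; rewrite e; lia.
Qed.

Lemma smon_ix_ge m a : - a%:Z <= smon_ix m a.
Proof. by rewrite /smon_ix; lia. Qed.

Lemma smon_ix_le m a : smon_ix m a <= smon_ix m 0.
Proof. by case: a => // a; apply/ltW/smon_ix_lt. Qed.

Lemma smon_ix_gt m a n : (a < n)%N -> - n%:Z < smon_ix m a.
Proof. by move=> h; have := smon_ix_ge m a; lia. Qed.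

Lemma smon_ix_head m a : (a < size m)%N -> - a%:Z < smon_ix m a.
Proof. by move=> /smon_nth_pos; rewrite /smon_ix; lia. Qed.

Lemma smon_ix_low m (j : int) : j <= - (size m)%:Z -> smon_ix m `|j|%N = j.
Proof. by move=> h; rewrite smon_ix_tail; lia. Qed.

Lemma smon_eq m m' : (forall a, smon_ix m a = smon_ix m' a) -> m = m'.
Proof.
move=> h; have hn a : nth 0%N m a = nth 0%N m' a.
  by have := h a; rewrite /smon_ix; lia.
have hs : size m = size m'.
  case: (ltngtP (size m) (size m')) => // hl.
    by have := smon_nth_pos hl; rewrite -hn nth_default.
  by have := smon_nth_pos hl; rewrite hn nth_default.
by apply: val_inj; apply: (@eq_from_nth _ 0%N).
Qed.

(** The lists of the first [n] indices are strictly decreasing of the same length, so inclusion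
    forces equality; beyond position [n] both monomials carry the vacuum indices. *)
Lemma smon_eq_mem m m' n : (size m <= n)%N -> (size m' <= n)%N ->
  (forall b, (b < n)%N -> exists2 a, (a < n)%N & smon_ix m a = smon_ix m' b) ->
  m = m'.
Proof.
move=> hm hm' hsub.
pose l m'' := [seq smon_ix m'' a | a <- iota 0 n].
have lsz m'' : size (l m'') = n by rewrite size_map size_iota.
have lun m'' : uniq (l m'').
  by rewrite map_inj_uniq ?iota_uniq //; apply: smon_ix_inj.
have lso m'' : sorted >%R (l m'').
  apply/(sortedP 0) => i; rewrite lsz => hi.
  rewrite !(nth_map 0%N) ?size_iota ?nth_iota //; try lia.
  by apply: smon_ix_lt.
have e : l m =i l m'.
  have sub : {subset l m' <= l m}; last first.
    have sz : (size (l m) <= size (l m'))%N by rewrite !lsz.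
    by have [_ e x] := uniq_min_size (lun m') sub sz; rewrite e.
  move=> x; case/mapP => b; rewrite mem_iota /= add0n => hb ->.
  case: (hsub b hb) => a ha <-.
  by apply: map_f; rewrite mem_iota.
have {}e : l m = l m'.
  apply: (sorted_eq (leT := >%R)) => //.
  - by move=> x y z /= h1 h2; apply: lt_trans h2 h1.
  - by move=> x y /= /andP[h1 h2]; have := lt_trans h1 h2; rewrite ltxx.
  - by apply: uniq_perm.
apply: smon_eq => a; case: (ltnP a n) => ha; last first.
  by rewrite !smon_ix_tail //; lia.
have := congr1 (fun t => nth 0 t a) e.
by rewrite !(nth_map 0%N) ?size_iota // nth_iota.
Qed.

(** The zeros of a decreasing list come last; once deleted, they are restored by the default value
    of [nth]. *)
Lemma sorted_geq_nth_filter (s : seq nat) k : sorted geq s ->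
  nth 0%N [seq x <- s | x != 0%N] k = nth 0%N s k.
Proof.
elim: s k => [|x s IH] k //= hs.
have hs' := path_sorted hs.
case: eqP => [x0|_] /=; last by case: k => //= k; apply: IH.
have all0 : all (pred1 0%N) s.
  apply/allP => y ys /=; rewrite -leqn0 -x0.
  have := order_path_min (leT := geq) (fun a b c h1 h2 => leq_trans h2 h1) hs.
  by move/allP/(_ _ ys).
rewrite (eq_in_filter (a2 := pred0)) ?filter_pred0 ?nth_nil; last first.
  by move=> y /(allP all0) /= /eqP ->.
case: k => [|k] /=; first by rewrite x0.
case: (ltnP k (size s)) => hk; last by rewrite nth_default.
by apply/esym/eqP/(allP all0)/mem_nth.
Qed.

(** Sort the tuple decreasingly and add its position to each entry: distinctness and the bound [-n]
    make the result a weakly decreasing list of naturals, a partition once its zeros are dropped. *)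
Lemma smon_of_tuple n (T : 'I_n -> int) : injective T ->
  (forall a, - n%:Z < T a) ->
  exists m (sg : 'S_n), (size m <= n)%N /\ forall a, T a = smon_ix m (sg a).
Proof.
move=> injT hT.
pose ts : seq int := sort >=%R [seq T a | a <- enum 'I_n].
have szts : size ts = n by rewrite size_sort size_map size_enum_ord.
have memts x : (x \in ts) = (x \in [seq T a | a <- enum 'I_n]) by rewrite mem_sort.
have uts : uniq ts by rewrite sort_uniq map_inj_uniq ?enum_uniq.
have tot : total (>=%R : rel int) by move=> x y; exact: le_total.
have sts : sorted >%R ts.
  have : sorted >=%R ts by apply: sort_sorted.
  move=> so; apply/(sortedP 0) => i hi.
  have : nth 0 ts i.+1 <= nth 0 ts i := (sortedP 0 so) i hi.
  rewrite le_eqVlt => /orP[/eqP e|//].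
  by have := nth_uniq 0 hi (ltnW hi) uts; rewrite e eqxx; lia.
have tgt k : (k < n)%N -> - n%:Z < nth 0 ts k.
  move=> hk; have : nth 0 ts k \in ts by rewrite mem_nth ?szts.
  by rewrite memts => /mapP[a _ ->].
have tge k : (k < n)%N -> - k%:Z <= nth 0 ts k.
  (* Downward induction from the last position, whose entry exceeds [-n]; each earlier entry is
     larger by at least 1. *)
  move=> hk; have [d e] : exists d, (k + d).+1 = n by exists (n - k.+1)%N; lia.
  elim: d k e {hk} => [|d IH] k e.
    have := tgt k; lia.
  have := IH k.+1; have := (sortedP 0 sts) k; rewrite szts => h1 h2.
  have {}h1 : nth 0 ts k.+1 < nth 0 ts k by apply: h1; lia.
  by have := h2 _; lia.
pose ps := [seq absz (nth 0 ts k + k%:Z) | k <- iota 0 n].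
have nps k : (k < n)%N -> (nth 0%N ps k)%:Z = nth 0 ts k + k%:Z.
  move=> hk; rewrite (nth_map 0%N) ?size_iota // nth_iota // add0n.
  by have := tge _ hk; lia.
have sps : sorted geq ps.
  apply/(sortedP 0%N) => i; rewrite size_map size_iota => hi.
  have h1 : nth 0 ts i.+1 < nth 0 ts i by apply: (sortedP 0 sts); rewrite szts.
  rewrite /geq /= -lez_nat !nps //; first by lia.
  exact: ltnW.
have hp : is_partition [seq x <- ps | x != 0%N].
  apply/andP; split; last by rewrite mem_filter.
  apply: sorted_filter => // x y z h1 h2; exact: leq_trans h2 h1.
pose m := Smon hp.
have hix k : (k < n)%N -> smon_ix m k = nth 0 ts k.
  by move=> hk; rewrite /smon_ix /= sorted_geq_nth_filter // nps // addrK.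
have hlt a : (index (T a) ts < n)%N.
  by rewrite -[X in (_ < X)%N]szts index_mem memts map_f ?mem_enum.
pose f a := Ordinal (hlt a).
have injf : injective f.
  move=> a b /(congr1 val) /= e; apply: injT.
  have hin c : T c \in ts by rewrite memts map_f ?mem_enum.
  by rewrite -(nth_index 0 (hin a)) e nth_index.
exists m, (perm injf); split.
  by rewrite /= size_filter (leq_trans (count_size _ _)) // size_map size_iota.
move=> a; rewrite permE hix //= nth_index //.
by rewrite memts map_f ?mem_enum.
Qed.

End Monomials.

(** * Minors and matrix elements of r(E_ij) *)

Section Minors.
Variable K : fieldType.
Implicit Types (m : smon) (v : fock K) (u : nat -> vect K).

Lemma det_corner_col n (F : nat -> nat -> K) :
  (forall a, (a < n)%N -> F a n = 0) ->
  \det (\matrix_(a < n.+1, b < n.+1) F a b)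
  = F n n * \det (\matrix_(a < n, b < n) F a b).
Proof.
move=> F0; rewrite (expand_det_col _ ord_max) big_ord_recr /= big1 => [|a _].
  rewrite add0r mxE /cofactor -signr_odd oddD addbb expr0 mul1r; congr (_ * \det _).
  by apply/matrixP=> a b; rewrite !mxE !lift_max.
by rewrite mxE F0 ?mul0r //= ltn_ord.
Qed.

Lemma det_corner_row n (F : nat -> nat -> K) :
  (forall b, (b < n)%N -> F n b = 0) ->
  \det (\matrix_(a < n.+1, b < n.+1) F a b)
  = F n n * \det (\matrix_(a < n, b < n) F a b).
Proof.
move=> F0; rewrite -det_tr -[in RHS]det_tr.
have e k : (\matrix_(a < k, b < k) F a b)^T = \matrix_(a < k, b < k) F b a.
  by apply/matrixP=> a b; rewrite !mxE.
by rewrite !e (det_corner_col (F := fun a b => F b a)).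
Qed.

Lemma wedge_minorS_col n u m : (forall a, (a < n)%N -> u n (smon_ix m a) = 0) ->
  wedge_minor n.+1 u m = u n (smon_ix m n) * wedge_minor n u m.
Proof. exact: (@det_corner_col n (fun a b => u b (smon_ix m a))). Qed.

Lemma wedge_minorS_row n u m : (forall b, (b < n)%N -> u b (smon_ix m n) = 0) ->
  wedge_minor n.+1 u m = u n (smon_ix m n) * wedge_minor n u m.
Proof. exact: (@det_corner_row n (fun a b => u b (smon_ix m a))). Qed.

(** The rows may sit at arbitrary indices, not only at those of a monomial, so that indices can be
    permuted, repeated or replaced. *)
Definition tuple_minor n (u : nat -> vect K) (T : 'I_n -> int) : K :=
  \det (\matrix_(a < n, b < n) (u b (T a) : K)).

Definition monoms m : nat -> vect K := fun b => vdelta K (smon_ix m b).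

Lemma tuple_minor_smon n u m :
  tuple_minor u (fun a : 'I_n => smon_ix m a) = wedge_minor n u m.
Proof. by []. Qed.

Lemma tuple_minor_perm n u (T : 'I_n -> int) (sg : 'S_n) :
  tuple_minor u (fun a => T (sg a)) = (-1) ^+ sg * tuple_minor u T.
Proof.
rewrite /tuple_minor; set M := (X in _ = _ * \det X).
have -> : (\matrix_(a < n, b < n) (u b (T (sg a)) : K)) = row_perm sg M.
  by apply/matrixP=> a b; rewrite !mxE.
by rewrite row_permE det_mulmx det_perm.
Qed.

Lemma tuple_minor_row0 n u (T : 'I_n -> int) a :
  (forall b, (b < n)%N -> u b (T a) = 0) -> tuple_minor u T = 0.
Proof.
move=> h; rewrite /tuple_minor (expand_det_row _ a) big1 // => b _.
by rewrite mxE h ?mul0r.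
Qed.

Lemma tuple_minor_col0 n u (T : 'I_n -> int) (b : 'I_n) :
  (forall a, u b (T a) = 0) -> tuple_minor u T = 0.
Proof.
move=> h; rewrite /tuple_minor (expand_det_col _ b) big1 // => a _.
by rewrite mxE h ?mul0r.
Qed.

Lemma tuple_minor_eq n u (T : 'I_n -> int) a a' :
  a != a' -> T a = T a' -> tuple_minor u T = 0.
Proof.
move=> naa e; apply: (determinant_alternate naa) => b; by rewrite !mxE e.
Qed.

Lemma tuple_minor_mem n (T : 'I_n -> int) m (b : nat) :
  tuple_minor (monoms m) T != 0 -> (b < n)%N -> exists a, T a = smon_ix m b.
Proof.
move=> h hb; apply: contrapT => /forallNP hn; move/eqP: h; apply.
apply: (@tuple_minor_col0 _ _ _ (Ordinal hb)) => a.
by rewrite /monoms /vdelta /=; case: eqP => // e; case: (hn a).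
Qed.

Lemma tuple_minor_mem_row n (T : 'I_n -> int) m a :
  tuple_minor (monoms m) T != 0 -> exists2 b, (b < n)%N & T a = smon_ix m b.
Proof.
move=> h; apply: contrapT => hn; move/eqP: h; apply.
apply: (@tuple_minor_row0 _ _ _ a) => b hb.
by rewrite /monoms /vdelta /=; case: eqP => // e; case: hn; exists b.
Qed.

(** A nonzero minor forces [T] to be a rearrangement of the first [n] indices of the monomial. *)
Lemma tuple_minor_uniq n (T : 'I_n -> int) m m' :
  (size m <= n)%N -> (size m' <= n)%N ->
  tuple_minor (monoms m) T != 0 -> tuple_minor (monoms m') T != 0 -> m = m'.
Proof.
move=> hm hm' h h'; apply: (smon_eq_mem hm hm') => b hb.
have [a ea] := tuple_minor_mem h' hb.
have [c hc ec] := tuple_minor_mem_row a h.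
by exists c => //; rewrite -ec.
Qed.

Lemma wedge_minor_self n m : wedge_minor n (monoms m) m = 1.
Proof.
rewrite /wedge_minor (_ : \matrix_(_, _) _ = 1%:M) ?det1 //.
apply/matrixP=> a b; rewrite !mxE /monoms /vdelta.
by rewrite (inj_eq (@smon_ix_inj m)).
Qed.

Lemma wedge_minor_monoms n m m0 : (size m <= n)%N -> (size m0 <= n)%N ->
  wedge_minor n (monoms m0) m = (m == m0)%:R.
Proof.
move=> hm hm0; case: eqP => [->|ne]; first exact: wedge_minor_self.
apply/eqP; apply: contrapT => /negP h; apply: ne.
apply: (@tuple_minor_uniq n (fun a => smon_ix m a)) => //.
by rewrite tuple_minor_smon wedge_minor_self oner_eq0.
Qed.

(* The n-truncated form of r_unit; it depends on n only through the number of
   filled levels that are counted. *)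
Definition r_trunc n (i j : int) m m0 : K :=
  \sum_(k < n)
    wedge_minor n
      (fun b => if b == k :> nat then unit_act i j (vdelta K (smon_ix m0 k))
                else vdelta K (smon_ix m0 b)) m.

(** Both monomials have [v_{-n}] at position [n]. In the terms that change an earlier factor the
    last column splits off with entry 1; the term that changes factor [n] survives only for
    [i = j = -n]. *)
Lemma r_truncS n i j m m0 : (size m <= n)%N -> (size m0 <= n)%N ->
  r_trunc n.+1 i j m m0
  = r_trunc n i j m m0 + ((i == - n%:Z) && (j == - n%:Z))%:R * (m == m0)%:R.
Proof.
move=> hm hm0; rewrite /r_trunc big_ord_recr /=; congr (_ + _).
  apply: eq_bigr => k _; rewrite wedge_minorS_col.
    by rewrite (gtn_eqF (ltn_ord k)) /vdelta (smon_ix_tail hm) (smon_ix_tail hm0) eqxx mul1r.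
  move=> a ha; rewrite (gtn_eqF (ltn_ord k)) /vdelta (smon_ix_tail hm0).
  by have := @smon_ix_gt m a n ha; case: eqP => // e; lia.
rewrite wedge_minorS_row.
  rewrite eqxx /unit_act /vdelta (smon_ix_tail hm) (smon_ix_tail hm0).
  rewrite -mulnb natrM [i == _]eq_sym; congr (_ * _).
  rewrite -(wedge_minor_monoms hm hm0) /wedge_minor; congr (\det _).
  by apply/matrixP=> a b; rewrite !mxE (ltn_eqF (ltn_ord b)).
move=> b hb; rewrite (ltn_eqF hb) /vdelta smon_ix_tail //.
by have := @smon_ix_gt m0 b n hb; case: eqP => // e; lia.
Qed.

(** The normal-ordering correction, summed over the first [n] filled levels, cancels the growth of
    [r_trunc] in [n]. Hence any [n] beyond both lengths may replace the bound built into
    [r_unit]. *)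
Lemma rhat_unit_trunc n i j m m0 : (size m <= n)%N -> (size m0 <= n)%N ->
  rhat_unit K i j m m0
  = r_trunc n i j m m0
    - \sum_(c < n) ((i == - c%:Z) && (j == - c%:Z))%:R * (m == m0)%:R.
Proof.
pose G k := r_trunc k i j m m0
    - \sum_(c < k) ((i == - c%:Z) && (j == - c%:Z))%:R * (m == m0)%:R.
move=> hm hm0.
have stab k d : (size m <= k)%N -> (size m0 <= k)%N -> G (k + d)%N = G k.
  move=> h1 h2; elim: d => [|d IH]; first by rewrite addn0.
  rewrite -IH addnS /G r_truncS; try lia.
  by rewrite big_ord_recr /= opprD addrACA subrr addr0.
rewrite -/(G n); pose n0 := (size m + size m0 + `|j| .+1)%N.
have -> : G n = G n0.
  rewrite -(stab n n0) // addnC stab //; rewrite /n0; lia.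
rewrite /rhat_unit /G; congr (_ - _).
case: ifP => [/andP[/eqP -> hj]|hF].
  have hj' : (`|j| < n0)%N by rewrite /n0; lia.
  rewrite (bigD1 (Ordinal hj')) //= big1 ?addr0 => [|c hc].
    have -> : - (`|j|%N)%:Z = j by lia.
    by rewrite eqxx mul1r; case: eqP.
  rewrite andbb; have -> : j == - c%:Z = false; last by rewrite mul0r.
  apply/eqP => e; move/eqP: hc; apply; apply: val_inj => /=; lia.
rewrite big1 // => c _.
have -> : (i == - c%:Z) && (j == - c%:Z) = false; last by rewrite mul0r.
by apply/negP => /andP[/eqP e1 /eqP e2]; move: hF; rewrite e1 e2 eqxx /=; lia.
Qed.

End Minors.

(** * Matrix coefficients of normal-ordered operators *)

Section Matel.
Variable K : fieldType.
Implicit Types (m : smon) (v : fock K) (u : nat -> vect K) (A : int -> int -> K).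

(** The infinite sums in [matel] and [rhat] are both evaluated in this way, after their terms are
    rewritten as finite sums of functions supported at one point. *)
Lemma fsbig_single (T : choiceType) (I : finType) (y : I -> T) (g : I -> T -> K) :
  (forall i x, x <> y i -> g i x = 0) ->
  \sum_(x \in [set: T]) (\sum_i g i x) = \sum_i g i (y i).
Proof.
move=> g0; pose r := undup [seq y i | i <- enum I].
have ry i : y i \in r by rewrite mem_undup map_f ?mem_enum.
rewrite (fsbigE r) ?undup_uniq //; last first.
  move=> x _ xr; rewrite big1 // => i _; apply: g0 => e.
  by move: xr; rewrite e ry.
rewrite (eq_bigl xpredT) => [|x]; last by rewrite in_setT.
rewrite exchange_big; apply: eq_bigr => i _.
rewrite (bigD1_seq (y i)) ?undup_uniq ?ry //= big1 ?addr0 // => x /eqP.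
exact: g0.
Qed.

Definition upd n (T : 'I_n -> int) (a : 'I_n) (j : int) : 'I_n -> int :=
  fun a' => if a' == a then j else T a'.

(** The cofactors along row [a] do not see that row, so they remain those of [T]. *)
Lemma tuple_minor_upd n u (T : 'I_n -> int) a j :
  tuple_minor u (upd T a j)
  = \sum_(b < n) u b j * cofactor (\matrix_(a < n, b < n) (u b (T a) : K)) a b.
Proof.
rewrite /tuple_minor (expand_det_row _ a); apply: eq_bigr => b _.
rewrite mxE /upd eqxx /cofactor; congr (_ * (_ * \det _)).
by apply/matrixP=> c d; rewrite !mxE eq_sym (negPf (neq_lift _ _)).
Qed.

Lemma cofactor_row0 n (M : 'M[K]_n) a b r : r != a ->
  (forall b', b' != b -> M r b' = 0) -> cofactor M a b = 0.
Proof.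
move=> ra h; rewrite /cofactor; case: n M a b r ra h => [M []//|n] M a b r ra h.
have [r' e] : exists r', r = lift a r'.
  by case: (unliftP a r) ra => [r' -> _|->]; [exists r' | rewrite eqxx].
rewrite (expand_det_row _ r') big1 ?mulr0 // => c _.
by rewrite !mxE -e h ?mul0r // eq_sym neq_lift.
Qed.

Definition matel A m m0 : K :=
  \sum_(p \in [set: int * int]) (A p.1 p.2 * rhat_unit K p.1 p.2 m m0).

Definition monom_mx n m m0 : 'M[K]_n :=
  \matrix_(a < n, b < n) (vdelta K (smon_ix m0 b) (smon_ix m a) : K).

(** The trace over the first [n] levels filled in the vacuum, which normal ordering subtracts. *)
Definition sea_tr n A : K := \sum_(c < n) A (- c%:Z) (- c%:Z).

Lemma r_trunc_cofactor n i j m m0 :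
  r_trunc K n i j m m0
  = \sum_(a < n) \sum_(b < n)
      ((i == smon_ix m a) && (j == smon_ix m0 b))%:R * cofactor (monom_mx n m m0) a b.
Proof.
rewrite exchange_big; apply: eq_bigr => b _.
rewrite /wedge_minor (expand_det_col _ b); apply: eq_bigr => a _.
rewrite mxE eqxx /unit_act /vdelta [smon_ix m a == i]eq_sym -natrM mulnb.
congr (_ * _); rewrite /cofactor; congr (_ * \det _).
apply/matrixP=> c d; rewrite !mxE.
have -> : (lift b d == b :> nat) = false by apply/negbTE; rewrite eq_sym; apply: neq_bump.
by [].
Qed.

Lemma matelE n A m m0 : (size m <= n)%N -> (size m0 <= n)%N ->
  matel A m m0
  = (\sum_(a < n) \sum_(b < n)
       A (smon_ix m a) (smon_ix m0 b) * cofactor (monom_mx n m m0) a b)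
    - sea_tr n A * (m == m0)%:R.
Proof.
move=> hm hm0.
pose I := ('I_n * 'I_n + 'I_n)%type.
pose y (i : I) : int * int := match i with
  | inl ab => (smon_ix m ab.1, smon_ix m0 ab.2)
  | inr c => (- c%:Z, - c%:Z) end.
pose w (i : I) : K := match i with
  | inl ab => cofactor (monom_mx n m m0) ab.1 ab.2
  | inr c => - (m == m0)%:R end.
pose g (i : I) p := (p == y i)%:R * (A p.1 p.2 * w i).
rewrite /matel (eq_fsbigr (fun p => \sum_i g i p)) => [|p _]; last first.
  rewrite (rhat_unit_trunc _ _ _ hm hm0) r_trunc_cofactor pair_big big_sumType /=.
  rewrite mulrBr [_ * \sum_(i < n) _]big_distrr /= -sumrN big_distrr /=.
  congr (_ + _); apply: eq_bigr => i _; rewrite /g /=; last first.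
    rewrite !mulrN !mulrA; congr (- (_ * _)).
    by rewrite mulrC -pair_eqE.
  by rewrite mulrA [_ * _%:R]mulrC -mulrA; congr (_ * _); rewrite -pair_eqE.
rewrite (@fsbig_single _ _ y) /= => [|i x /eqP/negPf e]; last by rewrite /g e mul0r.
rewrite big_sumType pair_big /=; congr (_ + _).
  by apply: eq_bigr => ab _; rewrite /g eqxx mul1r.
rewrite /sea_tr big_distrl -sumrN /=; apply: eq_bigr => c _.
by rewrite /g eqxx mul1r /= mulrN.
Qed.

(* A monomial with more than n parts lacks an index that the rows of m beyond n
   can only move onto filled positions. *)
Lemma matel_big A n m m0 : (size m <= n)%N -> (n < size m0)%N ->
  (forall a j, (n <= a)%N -> A (- a%:Z) j != 0 -> j <= - (size m)%:Z) ->
  matel A m m0 = 0.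
Proof.
move=> hm hn hA; have hm' : (size m <= size m0)%N by lia.
rewrite (matelE _ hm' (leqnn _)).
have -> : (m == m0) = false by apply/eqP => e; move: hn; rewrite -e; lia.
rewrite mulr0 subr0 big1 // => a _; rewrite big1 // => b _.
have [/eqP ->|hA0] := boolP (A (smon_ix m a) (smon_ix m0 b) == 0).
  by rewrite mul0r.
rewrite [cofactor _ _ _](_ : _ = 0) ?mulr0 //.
(* The first [size m0] indices of [m0] all exceed [-k], whereas [m] has [-k] at position [k]; this
   row of the minor is zero and must be the deleted one. *)
pose k := (size m0).-1; have hk : (k < size m0)%N by rewrite /k; lia.
have low b' : (b' < size m0)%N -> - k%:Z < smon_ix m0 b'.
  by move=> hb; have := smon_ix_head hb; rewrite /k; lia.
case: (eqVneq (Ordinal hk) a) => [ea|na]; last first.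
  apply: (cofactor_row0 na) => b' _; rewrite mxE /vdelta /= smon_ix_tail; last first.
    by rewrite /k; lia.
  by have := low b' (ltn_ord b'); case: eqP => // e; lia.
have {}ea : nat_of_ord a = k by rewrite -ea.
have hSa : smon_ix m a = - k%:Z by rewrite smon_ix_tail ea // /k; lia.
(* The deleted factor moves to an index that [m] also fills, in another row; the only nonzero entry
   of that row lies in the deleted column [b]. *)
have hj : smon_ix m0 b <= - (size m)%:Z by apply: (hA k) => //; [rewrite /k; lia|rewrite -hSa].
have lb := low b (ltn_ord b).
have hc : (`|smon_ix m0 b| < size m0)%N by lia.
apply: (@cofactor_row0 _ _ _ _ (Ordinal hc)).
  by apply/eqP => /(congr1 val) /=; rewrite ea; lia.
move=> b' hb'; rewrite mxE /vdelta /= smon_ix_low //.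
by rewrite (inj_eq (@smon_ix_inj _)) -[b == _ :> nat]/(b == b') eq_sym (negPf hb').
Qed.

End Matel.

(** * Fock vectors as alternating functions *)

Section Extension.
Variable K : fieldType.
Implicit Types (m : smon) (v : fock K) (u : nat -> vect K) (A : int -> int -> K).

(** The monomial whose first [n] indices are those of [T] up to order. If there is none, the default
    is the vacuum, whose minor, the sign in [ext], is then 0. *)
Definition tuple_smon n (T : 'I_n -> int) : smon :=
  xget smon_vac [set m : smon | (size m <= n)%N /\ tuple_minor (monoms K m) T != 0].

(* The coefficients of v extended to an alternating function of n-tuples of
   indices, an n-tuple T standing for v_{T 0} /\ ... /\ v_{T (n-1)} /\ v_{-n} /\ ... *)
Definition ext n v (T : 'I_n -> int) : K :=
  tuple_minor (monoms K (tuple_smon T)) T * v (tuple_smon T).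

Lemma size_tuple_smon n (T : 'I_n -> int) : (size (tuple_smon T) <= n)%N.
Proof. by rewrite /tuple_smon; case: xgetP => [m _ []|]. Qed.

Lemma tuple_smon_eq n (T : 'I_n -> int) m : (size m <= n)%N ->
  tuple_minor (monoms K m) T != 0 -> tuple_smon T = m.
Proof.
move=> hm h; rewrite /tuple_smon; case: xgetP => [m' -> [h1 h2]|/(_ m)[]//].
exact: tuple_minor_uniq h1 hm h2 h.
Qed.

Lemma tuple_minor_neq n (T : 'I_n -> int) m : (size m <= n)%N ->
  m <> tuple_smon T -> tuple_minor (monoms K m) T = 0.
Proof.
by move=> hm ne; apply/eqP/negP => h; apply: ne; rewrite (tuple_smon_eq hm) //; apply/negP.
Qed.

Lemma ext_smon n v m : (size m <= n)%N ->
  ext v (fun a : 'I_n => smon_ix m a) = v m.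
Proof.
move=> hm; have h : tuple_minor (monoms K m) (fun a : 'I_n => smon_ix m a) = 1.
  by rewrite tuple_minor_smon wedge_minor_self.
by rewrite /ext (tuple_smon_eq hm) h ?mul1r ?oner_eq0.
Qed.

Lemma ext_perm n v (T : 'I_n -> int) (sg : 'S_n) :
  ext v (fun a => T (sg a)) = (-1) ^+ sg * ext v T.
Proof.
rewrite /ext; have -> : tuple_smon (fun a => T (sg a)) = tuple_smon T.
  rewrite /tuple_smon; congr xget; apply/funext => m /=; apply/propext.
  by rewrite tuple_minor_perm mulf_eq0 signr_eq0.
by rewrite tuple_minor_perm mulrA.
Qed.

Lemma eq_ext n v (T T' : 'I_n -> int) : T =1 T' -> ext v T = ext v T'.
Proof. by move=> /funext ->. Qed.

(** The tail [v_{-n}], [v_{-n-1}], ... lies beyond the tuple, so none of the first [n] indices of a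
    monomial can be so low. *)
Lemma ext_low n v (T : 'I_n -> int) a : T a <= - n%:Z -> ext v T = 0.
Proof.
move=> h; rewrite /ext (@tuple_minor_row0 _ _ _ _ a) ?mul0r // => b hb.
rewrite /monoms /vdelta; case: eqP => // e.
by have := @smon_ix_gt (tuple_smon T) b n hb; lia.
Qed.

Lemma ext_eq0 n v (T : 'I_n -> int) a a' : a != a' -> T a = T a' -> ext v T = 0.
Proof. by move=> h1 h2; rewrite /ext (tuple_minor_eq _ h1 h2) mul0r. Qed.

Lemma ext_linear n c v v' (T : 'I_n -> int) :
  ext (c *: v + v') T = c * ext v T + ext v' T.
Proof. by rewrite /ext -[(c *: v + v') _]/(c * v _ + v' _); ring. Qed.

(** Numbers the window [-n < j <= M] by [x < n + M]. *)
Definition win n (x : nat) : int := x%:Z + 1 - n%:Z.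

Lemma winP n M (j : int) : - n%:Z < j -> j <= M%:Z -> exists x : 'I_(n + M), j = win n x.
Proof.
move=> h1 h2; have hx : (absz (j + n%:Z - 1)%R < n + M)%N by lia.
by exists (Ordinal hx); rewrite /win /=; lia.
Qed.

Lemma sum_win n M (j : int) (f : int -> K) : - n%:Z < j ->
  (f j != 0 -> j <= M%:Z) ->
  \sum_(x < n + M) f (win n x) * (win n x == j)%:R = f j.
Proof.
move=> h1 h2; have [fj|/h2 h3] := eqVneq (f j) 0.
  rewrite fj big1 // => x _; case: eqP => [->|]; by rewrite ?fj ?mul0r ?mulr0.
have [x ex] := winP h1 h3; rewrite (bigD1 x) //= -ex eqxx mulr1 big1 ?addr0 //.
move=> y hy; case: eqP; rewrite ?mulr0 // ex /win => e.
by case/eqP: hy; apply: val_inj => /=; lia.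
Qed.

(* Transposed form of the derivation: rather than moving the factors of the
   monomials of v, it moves the indices of the coefficient that is read off. *)
Lemma rhatE n M A v m : (size m <= n)%N ->
  (forall a j, (n <= a)%N -> A (- a%:Z) j != 0 -> j <= - (size m)%:Z) ->
  (forall a j, (a < n)%N -> A (smon_ix m a) j != 0 -> j <= M%:Z) ->
  rhat A v m
  = \sum_(a < n) \sum_(x < n + M) A (smon_ix m a) (win n x)
        * ext v (upd (fun a : 'I_n => smon_ix m a) a (win n x))
    - sea_tr n A * v m.
Proof.
move=> hm hA1 hA2.
pose S : 'I_n -> int := fun a => smon_ix m a.
pose I := ('I_n * 'I_(n + M) + unit)%type.
pose y (i : I) : smon := match i with
  | inl ax => tuple_smon (upd S ax.1 (win n ax.2))
  | inr _ => m end.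
(* Monomials with more than [n] parts are cut off explicitly: their [n]-minor may be nonzero
   although their matrix element vanishes by [matel_big]. *)
pose g (i : I) (m0 : smon) : K := match i with
  | inl ax => A (S ax.1) (win n ax.2) *
       (if (size m0 <= n)%N then tuple_minor (monoms K m0) (upd S ax.1 (win n ax.2)) else 0)
       * v m0
  | inr _ => - sea_tr n A * (m == m0)%:R * v m0 end.
rewrite /rhat (eq_fsbigr (fun m0 => \sum_i g i m0)) => [|m0 _]; last first.
  rewrite -/(matel A m m0) big_sumType /= -!big_distrl /= -mulrDl; congr (_ * _).
  rewrite big_const card_unit /= addr0.
  case: (leqP (size m0) n) => hn; last first.
    rewrite (matel_big hm hn hA1) big1 ?add0r => [|i _]; last by rewrite mulr0.
    by case: eqP => [e|]; rewrite ?mulr0 //; move: hn; rewrite -e; lia.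
  rewrite (matelE _ hm hn) mulNr; congr (_ - _).
  rewrite -(pair_big xpredT xpredT (fun a (x : 'I_(n + M)) => A (S a) (win n x) *
     tuple_minor (monoms K m0) (upd S a (win n x)))) /=.
  apply: eq_bigr => a _; under [RHS]eq_bigr do rewrite tuple_minor_upd big_distrr.
  rewrite exchange_big /=; apply: eq_bigr => b _.
  under eq_bigr do rewrite mulrA.
  rewrite -big_distrl /= -/(monom_mx K n m m0); congr (_ * _).
  rewrite (@sum_win _ _ _ (A (S a))) // ?smon_ix_gt //; exact: hA2.
rewrite (@fsbig_single _ _ _ y); last first.
  case=> [[a x]|[]] m0 /= ne.
    by case: ifP => hn; rewrite ?mulr0 ?mul0r // tuple_minor_neq ?mulr0 ?mul0r.
  by have /eqP/negPf -> := nesym ne; rewrite mulr0 mul0r.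
rewrite big_sumType /=; congr (_ + _).
  rewrite pair_big /=; apply: eq_bigr => ax _.
  by rewrite size_tuple_smon /ext mulrA.
by rewrite big_const card_unit /= addr0 eqxx mulr1 mulNr.
Qed.

End Extension.

(** * The commutator of two derivations *)

Section Derivations.
Variable K : numFieldType.
Implicit Types (m : smon) (v : fock K) (A B : int -> int -> K) (L n M : nat).

Definition banded L A := forall i j, A i j != 0 -> (i - L%:Z <= j) && (j <= i + L%:Z).

(** With both indices confined to the window, the formula for [rhat] holds at every monomial of at
    most [n] parts, without a margin for the band. This is what allows iteration at a fixed [n]. *)
Definition trunc n M A : int -> int -> K := fun i j =>
  if [&& - n%:Z < i, i <= M%:Z, - n%:Z < j & j <= M%:Z] then A i j else 0.

(** The second quantization of [A], acting on functions of [n] indices. *)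
Definition opn n M A (f : ('I_n -> int) -> K) (T : 'I_n -> int) : K :=
  \sum_(a < n) \sum_(x < n + M) A (T a) (win n x) * f (upd T a (win n x)).

Lemma rhat_band L n M A v m : banded L A -> (size m + L <= n)%N ->
  smon_ix m 0 + L%:Z <= M%:Z ->
  rhat A v m
  = opn M A (@ext K n v) (fun a => smon_ix m a) - sea_tr n A * v m.
Proof.
move=> bA hn hM; apply: rhatE; first by lia.
  by move=> a j ha /bA; lia.
by move=> a j ha /bA; have := smon_ix_le m a; lia.
Qed.

Lemma truncE n M A i j : - n%:Z < i -> i <= M%:Z -> - n%:Z < j -> j <= M%:Z ->
  trunc n M A i j = A i j.
Proof. by rewrite /trunc => -> -> -> ->. Qed.

Lemma sea_tr_trunc n M A : sea_tr n (trunc n M A) = sea_tr n A.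
Proof. by apply: eq_bigr => c _; rewrite truncE //; have := ltn_ord c; lia. Qed.

Lemma rhat_trunc n M A v m : (size m <= n)%N ->
  rhat (trunc n M A) v m
  = opn M (trunc n M A) (@ext K n v) (fun a => smon_ix m a) - sea_tr n A * v m.
Proof.
move=> hn; rewrite -(sea_tr_trunc n M); apply: rhatE => // a j ha.
  by rewrite /trunc; case: ifP; [lia|rewrite eqxx].
by rewrite /trunc; case: ifP; [lia|rewrite eqxx].
Qed.

Lemma win_gt n x : - n%:Z < win n x.
Proof. by rewrite /win; lia. Qed.

Lemma win_le n M (x : 'I_(n + M)) : win n x <= M%:Z.
Proof. by rewrite /win; have := ltn_ord x; lia. Qed.

Lemma rhat_band_trunc L n M A v m : banded L A -> (size m + L <= n)%N ->
  smon_ix m 0 + L%:Z <= M%:Z -> rhat A v m = rhat (trunc n M A) v m.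
Proof.
move=> bA hn hM; rewrite (rhat_band _ bA hn hM) rhat_trunc; last by lia.
congr (_ - _); apply: eq_bigr => a _; apply: eq_bigr => x _.
rewrite truncE ?win_gt ?win_le ?smon_ix_gt //.
by have := smon_ix_le m a; lia.
Qed.

Lemma opn_perm n M A v (T : 'I_n -> int) (sg : 'S_n) :
  opn M A (ext v) (fun a => T (sg a)) = (-1) ^+ sg * opn M A (ext v) T.
Proof.
rewrite /opn [in RHS](reindex_inj (@perm_inj _ sg)) big_distrr /=.
apply: eq_bigr => a _; rewrite big_distrr; apply: eq_bigr => x _ /=.
rewrite [RHS]mulrCA -(ext_perm v (upd T (sg a) (win n x)) sg).
congr (_ * _); apply: eq_ext => b.
by rewrite /upd (inj_eq (@perm_inj _ sg)).
Qed.

Lemma opn_eq0 n M A v (T : 'I_n -> int) a a' : a != a' -> T a = T a' ->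
  opn M A (ext v) T = 0.
Proof.
move=> naa e; have := opn_perm M A v T (tperm a a').
have -> : (fun b => T (tperm a a' b)) = T.
  by apply/funext => b; case: tpermP => // ->.
rewrite odd_tperm naa expr1 mulN1r => h.
have : opn M A (ext v) T *+ 2 = 0 by rewrite mulr2n -{2}[opn _ _ _ _]opprK -h subrr.
by move/eqP; rewrite mulrn_eq0 => /eqP.
Qed.

(** Both sides are alternating in [T] and vanish when an index is repeated or at most [-n]; this
    leaves the tuples that come from monomials. *)
Lemma ext_rhat_trunc n M A v (T : 'I_n -> int) :
  ext (rhat (trunc n M A) v) T
  = opn M (trunc n M A) (ext v) T - sea_tr n A * ext v T.
Proof.
have [[a ha]|hlow] := pselect (exists a, T a <= - n%:Z).
  rewrite !(ext_low _ ha) mulr0 subr0 /opn big1 // => b _; rewrite big1 // => x _.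
  have [->|nb] := eqVneq b a.
    by rewrite /trunc [- n%:Z < T a]ltNge ha /= mul0r.
  by rewrite (@ext_low _ _ _ _ a) ?mulr0 // /upd eq_sym (negPf nb).
have [injT|ninj] := pselect (injective T); last first.
  have [a [a' [naa e]]] : exists a a', a != a' /\ T a = T a'.
    apply: contrapT => h; apply: ninj => a a' e; apply: contrapT => /eqP naa.
    by apply: h; exists a, a'.
  by rewrite !(ext_eq0 _ naa e) (opn_eq0 _ _ _ naa e) mulr0 subr0.
have {}hlow a : - n%:Z < T a by rewrite ltNge; apply/negP => h; apply: hlow; exists a.
have [m [sg [hm /funext ->]]] := smon_of_tuple injT hlow.
pose S : 'I_n -> int := fun a => smon_ix m a.
rewrite !(ext_perm _ S) (opn_perm _ _ _ S).
by rewrite !ext_smon // rhat_trunc // mulrBr; congr (_ - _); rewrite mulrCA.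
Qed.

(** The outer operator is evaluated in the smaller window given by [size m + L] and [M1]. The inner
    one is then read only at monomials inside that window, which costs a second margin [L]. *)
Lemma rhat_band_comp L n M A B v m : banded L A -> banded L B ->
  (size m + 2 * L <= n)%N -> smon_ix m 0 + (2 * L)%N%:Z <= M%:Z ->
  rhat A (rhat B v) m = rhat (trunc n M A) (rhat (trunc n M B) v) m.
Proof.
move=> bA bB hn hM; rewrite -(rhat_band_trunc _ bA); try lia.
pose M1 := absz (smon_ix m 0 + L%:Z).
have h0 := smon_ix_ge m 0.
have hM1 : M1%:Z = smon_ix m 0 + L%:Z by rewrite /M1; lia.
have hle : smon_ix m 0 + L%:Z <= M1%:Z by rewrite hM1.
have bd w : rhat A w m = _ := rhat_band w bA (leqnn (size m + L)) hle.
rewrite !bd.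
have e w m' : (size m' <= size m + L)%N -> smon_ix m' 0 <= M1%:Z ->
    rhat B w m' = rhat (trunc n M B) w m'.
  by move=> h1 h2; rewrite -(rhat_band_trunc _ bB) //; lia.
rewrite e; [|lia|lia]; congr (_ - _).
apply: eq_bigr => a _; apply: eq_bigr => x _; congr (_ * _).
rewrite /ext; set T := upd _ _ _; set mT := tuple_smon _ T.
have [->|hT] := eqVneq (tuple_minor (monoms K mT) T) 0; first by rewrite !mul0r.
rewrite e //; first exact: size_tuple_smon.
have n0 : (0 < size m + L)%N by have := ltn_ord a; lia.
have [c <-] := tuple_minor_mem hT n0.
rewrite /T /upd; case: eqP => _; first exact: win_le.
by have := smon_ix_le m c; lia.
Qed.

Definition mxwin n M A B : int -> int -> K := fun i k =>
  \sum_(x < n + M) A i (win n x) * B (win n x) k.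

(** A product of two one-body operators is the one-body operator of the matrix product, where both
    move the same index, plus a two-body part [X], which is symmetric in [A] and [B] and cancels. *)
Lemma opn_comm n M A B (f : ('I_n -> int) -> K) T :
  opn M A (opn M B f) T - opn M B (opn M A f) T
  = opn M (fun i k => mxwin n M A B i k - mxwin n M B A i k) f T.
Proof.
pose X A B := \sum_(a < n) \sum_(b < n) \sum_(x < n + M) \sum_(y < n + M)
  (if b == a then 0 else
   A (T a) (win n x) * B (T b) (win n y) * f (upd (upd T a (win n x)) b (win n y))).
have split A' B' : opn M A' (opn M B' f) T = opn M (mxwin n M A' B') f T + X A' B'.
  rewrite -big_split /=; apply: eq_bigr => a _.
  transitivity (\sum_(b < n) \sum_(x < n + M) \sum_(y < n + M)
    A' (T a) (win n x) * (B' (upd T a (win n x) b) (win n y)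
                          * f (upd (upd T a (win n x)) b (win n y)))).
    rewrite exchange_big; apply: eq_bigr => x _; rewrite big_distrr.
    by apply: eq_bigr => b _; rewrite big_distrr.
  rewrite (bigD1 a) //= [X in _ = _ + X](bigD1 a) //= addrA; congr (_ + _).
    rewrite eqxx [X in _ + X]big1 ?addr0 => [|x _]; last by rewrite big1.
    rewrite exchange_big; apply: eq_bigr => y _ /=.
    rewrite /mxwin big_distrl; apply: eq_bigr => x _ /=.
    rewrite {1}/upd eqxx mulrA; congr (_ * f _).
    by apply/funext => c; rewrite /upd; case: eqP.
  apply: eq_bigr => b nb; apply: eq_bigr => x _; apply: eq_bigr => y _.
  by rewrite (negPf nb) {1}/upd (negPf nb) mulrA.
have Xsym : X A B = X B A.
  rewrite /X exchange_big; apply: eq_bigr => b _; apply: eq_bigr => a _.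
  rewrite exchange_big; apply: eq_bigr => y _; apply: eq_bigr => x _.
  rewrite [b == a]eq_sym; case: eqP => // /eqP nab; rewrite [X in X * _]mulrC.
  congr (_ * f _); apply/funext => c; rewrite /upd.
  by case: eqP => [->|//]; case: eqP => // e; rewrite e eqxx in nab.
rewrite !split Xsym opprD addrACA subrr addr0 -sumrB.
apply: eq_bigr => a _; rewrite -sumrB; apply: eq_bigr => x _.
by rewrite mulrBl.
Qed.

End Derivations.

(** * Commutators up to a scalar *)

Section Commutator.
Variable K : numFieldType.
Implicit Types (m : smon) (v : fock K) (A B E : int -> int -> K) (L n M : nat).

(** [E] is the commutator of [A] and [B], tested on rows at distance [L] from the edges, where the
    band of the row fits into the window and the windowed product is the full one. *)
Definition commutes_to L A B E := forall n M i k,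
  - n%:Z < i - L%:Z -> i + L%:Z <= M%:Z ->
  E i k = mxwin n M A B i k - mxwin n M B A i k.

Lemma mxwin_band L n M A B i k : banded L A -> banded L B ->
  mxwin n M A B i k != 0 -> k <= i + (2 * L)%N%:Z.
Proof.
move=> bA bB; apply: contraR => hk; rewrite /mxwin big1 // => x _.
have [->|/bA hA] := eqVneq (A i (win n x)) 0; first by rewrite mul0r.
by have [->|/bB hB] := eqVneq (B (win n x) k) 0; [rewrite mulr0 | lia].
Qed.

(** The index [j] is filled in [m], so moving a factor there repeats an index unless the factor
    already sits at [j]. *)
Lemma ext_upd_low n v m (a : 'I_n) j : (size m <= n)%N ->
  - n%:Z < j -> j <= - (size m)%:Z ->
  ext v (upd (fun a : 'I_n => smon_ix m a) a j) = (j == smon_ix m a)%:R * v m.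
Proof.
move=> hn h1 h2; case: eqP => [->|ne]; last first.
  have hj : (absz j < n)%N by lia.
  rewrite mul0r; apply: (@ext_eq0 _ _ _ _ a (Ordinal hj)).
    by apply/eqP => e; apply: ne; rewrite e /= smon_ix_low.
  rewrite /upd eqxx; case: eqP => [e|_]; last by rewrite /= smon_ix_low.
  by [].
rewrite mul1r -(ext_smon v hn); apply: eq_ext => b; rewrite /upd.
by case: eqP => [->|].
Qed.

Lemma opnB n M A (f g : ('I_n -> int) -> K) c T :
  opn M A (fun T => f T - c * g T) T = opn M A f T - c * opn M A g T.
Proof.
rewrite /opn big_distrr -sumrB; apply: eq_bigr => a _ /=.
rewrite big_distrr -sumrB; apply: eq_bigr => x _ /=; ring.
Qed.

(** The scalar depends on the window but not on [m] or [v]. It is the usual cocycle of infinite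
    matrices: the terms with both indices nonpositive cancel, and those that pass through positive
    indices remain. *)
Lemma rhat_comm_aux L n M A B E v m :
  banded L A -> banded L B -> banded (2 * L) E -> commutes_to L A B E ->
  (size m + 3 * L <= n)%N -> smon_ix m 0 + (2 * L)%N%:Z <= M%:Z ->
  rhat A (rhat B v) m - rhat B (rhat A v) m
  = rhat E v m
    + (\sum_(c < n) (mxwin n M A B (- c%:Z) (- c%:Z) - mxwin n M B A (- c%:Z) (- c%:Z)))
      * v m.
Proof.
move=> bA bB bE hE hn hM; have h0 := smon_ix_ge m 0.
have hn' : (size m <= n)%N by lia.
pose S : 'I_n -> int := fun a => smon_ix m a.
have hn2 : (size m + 2 * L <= n)%N by lia.
rewrite (rhat_band_comp v bA bB hn2 hM) (rhat_band_comp v bB bA hn2 hM).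
rewrite (rhat_trunc M A (rhat (trunc n M B) v) hn') (rhat_trunc M B (rhat (trunc n M A) v) hn').
have ex C : @ext K n (rhat (trunc n M C) v) =
    (fun T => opn M (trunc n M C) (ext v) T - sea_tr n C * ext v T).
  by apply/funext => T; rewrite ext_rhat_trunc.
rewrite !ex (opnB M _ (opn M (trunc n M B) (ext v))).
rewrite (opnB M _ (opn M (trunc n M A) (ext v))) (rhat_trunc M A v hn') (rhat_trunc M B v hn') -/S.
have := opn_comm M (trunc n M A) (trunc n M B) (ext v) S.
set C0 := (fun i k : int => mxwin n M (trunc n M A) _ i k - _) => hc.
set a1 := opn _ _ (opn _ _ _) _; set a2 := opn _ _ (opn _ _ _) _.
have -> : a1 = a2 + opn M C0 (ext v) S by rewrite -hc -/a1 -/a2 addrC subrK.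
rewrite (rhat_band v bE hn2 hM) -/S.
set C := fun i k : int => mxwin n M A B i k - mxwin n M B A i k.
suff -> : opn M C0 (ext v) S
    = opn M E (ext v) S + \sum_(c < n) (C (- c%:Z) (- c%:Z) - E (- c%:Z) (- c%:Z)) * v m.
  rewrite -big_distrl sumrB /= /sea_tr /C; ring.
(* Cutting the matrices off changes [A, B] only in the corner next to -n, where
   all positions are filled; hence only the diagonal of the difference counts. *)
apply/eqP; rewrite addrC -subr_eq -sumrB; apply/eqP; apply: eq_bigr => a _.
rewrite -sumrB.
have hS : S a <= M%:Z by have := smon_ix_le m a; rewrite /S; lia.
have C0E k : - n%:Z < k -> k <= M%:Z -> C0 (S a) k = C (S a) k.
  move=> hk1 hk2; rewrite /C0 /C /mxwin.
  by congr (_ - _); apply: eq_bigr => x _; rewrite !truncE ?win_gt ?win_le ?smon_ix_gt.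
transitivity (\sum_(x < n + M) (C (S a) (win n x) - E (S a) (win n x))
   * ext v (upd S a (win n x))).
  by apply: eq_bigr => x _; rewrite (C0E _ (win_gt _ _) (win_le _)) [RHS]mulrBl.
have ha := ltn_ord a.
have [hlow|hhigh] := lerP (S a) (- n%:Z + L%:Z); last first.
  have eqC i k : i <= M%:Z - L%:Z -> - n%:Z + L%:Z < i -> C i k - E i k = 0.
    by move=> h1 h2; rewrite (hE n M) ?subrr //; lia.
  have hSa := smon_ix_le m a.
  rewrite big1 => [|x _]; last by rewrite eqC ?mul0r //; rewrite /S; lia.
  rewrite eqC ?mul0r //; first by lia.
  have [ham|ham] := ltnP a (size m); first by lia.
  by move: hhigh; rewrite /S smon_ix_tail.
have Sa : S a = - a%:Z.
  by apply: smon_ix_tail; have := smon_ix_ge m a; move: hlow; rewrite /S; lia.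
transitivity (\sum_(x < n + M) ((C (S a) (win n x) - E (S a) (win n x)) * v m)
   * (win n x == S a)%:R); last first.
  rewrite (@sum_win _ n M (S a) (fun j => (C (S a) j - E (S a) j) * v m)) //.
    by rewrite Sa.
  by rewrite /S; apply: smon_ix_gt.
apply: eq_bigr => x _.
have [->|ne] := eqVneq (C (S a) (win n x) - E (S a) (win n x)) 0.
  by rewrite !mul0r.
rewrite ext_upd_low ?win_gt //; first by rewrite mulrA [RHS]mulrAC.
have : win n x <= S a + (2 * L)%N%:Z; last by lia.
move: ne; rewrite /C; apply: contraR => hw.
have z1 : mxwin n M A B (S a) (win n x) = 0.
  by apply/eqP; apply: contraNT hw => /(mxwin_band bA bB).
have z2 : mxwin n M B A (S a) (win n x) = 0.
  by apply/eqP; apply: contraNT hw => /(mxwin_band bB bA).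
have z3 : E (S a) (win n x) = 0.
  by apply/eqP; apply: contraNT hw => /bE /andP[].
by rewrite z1 z2 z3 !subr0.
Qed.

(** The constant is read off at the vacuum, without reference to a window. A window that serves both
    [m] and the vacuum shows that it is also the scalar at [m]. *)
Lemma rhat_comm L A B E :
  banded L A -> banded L B -> banded (2 * L) E -> commutes_to L A B E ->
  exists c, forall v, rhat A (rhat B v) - rhat B (rhat A v) = rhat E v + c *: v.
Proof.
move=> bA bB bE hE; pose k0 := ket K smon_vac.
exists (rhat A (rhat B k0) smon_vac - rhat B (rhat A k0) smon_vac - rhat E k0 smon_vac).
move=> v; apply/funext => m.
pose n := (size m + 3 * L)%N; pose M := (absz (smon_ix m 0) + 2 * L)%N.
have h0 := smon_ix_ge m 0.
have hn : (size smon_vac + 3 * L <= n)%N by rewrite /n /=; lia.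
have hM : smon_ix smon_vac 0 + (2 * L)%N%:Z <= M%:Z by rewrite /smon_ix /M /=; lia.
rewrite (rhat_comm_aux k0 bA bB bE hE hn hM).
have -> : k0 smon_vac = 1 by rewrite /k0 /ket eqxx.
rewrite mulr1 addrAC subrr add0r.
have hMv : smon_ix m 0 + (2 * L)%N%:Z <= M%:Z by rewrite /M; lia.
exact: (rhat_comm_aux v bA bB bE hE (leqnn n) hMv).
Qed.

End Commutator.

(** * Derivations preserving a plane *)

Section Linearity.
Variable K : numFieldType.
Implicit Types (m : smon) (v : fock K) (A B : int -> int -> K).

Lemma rhat_linear L A c u v : banded L A ->
  rhat A (c *: u + v) = c *: rhat A u + rhat A v.
Proof.
move=> bA; apply/funext => m; pose n := (size m + L)%N.
pose M := (absz (smon_ix m 0) + L)%N; have h0 := smon_ix_ge m 0.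
have hM : smon_ix m 0 + L%:Z <= M%:Z by rewrite /M; lia.
have e w : rhat A w m = _ := rhat_band w bA (leqnn n) hM.
rewrite -[RHS]/(c * rhat A u m + rhat A v m) !e -[(c *: u + v) m]/(c * u m + v m).
have -> : opn M A (@ext K n (c *: u + v)) (fun a => smon_ix m a)
    = c * opn M A (@ext K n u) (fun a => smon_ix m a)
      + opn M A (@ext K n v) (fun a => smon_ix m a); last by ring.
rewrite /opn big_distrr -big_split; apply: eq_bigr => a _ /=.
rewrite big_distrr -big_split; apply: eq_bigr => x _ /=.
by rewrite ext_linear; ring.
Qed.

Lemma rhat_linear_mx L A B c v : banded L A -> banded L B ->
  rhat (fun i j => c * A i j + B i j) v = c *: rhat A v + rhat B v.
Proof.
move=> bA bB; apply/funext => m; pose n := (size m + L)%N.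
pose M := (absz (smon_ix m 0) + L)%N; have h0 := smon_ix_ge m 0.
have hM : smon_ix m 0 + L%:Z <= M%:Z by rewrite /M; lia.
rewrite -[RHS]/(c * rhat A v m + rhat B v m).
rewrite (rhat_band v bA (leqnn n) hM) (rhat_band v bB (leqnn n) hM).
pose C i j := c * A i j + B i j; have bC : banded L C.
  move=> i j; rewrite /C; have [->|/bA//] := eqVneq (A i j) 0.
  by have [->|/bB//] := eqVneq (B i j) 0; rewrite /C mulr0 addr0 eqxx.
rewrite -/C (rhat_band v bC (leqnn n) hM) /sea_tr [\sum_(c0 < n) C _ _]big_split /=.
rewrite -big_distrr /=.
have -> : opn M C (@ext K n v) (fun a => smon_ix m a)
    = c * opn M A (@ext K n v) (fun a => smon_ix m a)
      + opn M B (@ext K n v) (fun a => smon_ix m a); last by ring.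
rewrite /opn big_distrr -big_split; apply: eq_bigr => a _ /=.
rewrite big_distrr -big_split; apply: eq_bigr => x _ /=; rewrite /C; ring.
Qed.

End Linearity.

(** * Wedges of frames and regularized traces *)

Section Wedges.
Variable K : numFieldType.
Implicit Types (m : smon) (w : nat -> vect K) (A : int -> int -> K) (G : vect K -> vect K).

Definition frame w := forall k, w k (- k%:Z) = 1 /\ forall i : int, i < - k%:Z -> w k i = 0.

Definition reduced w := forall k c : nat, w k (- c%:Z) = (k == c)%:R.

Lemma reduced_frame w : reduced w -> frame w.
Proof.
move=> rw k; split=> [|i hi]; first by rewrite rw eqxx.
have -> : i = - (absz i)%:Z by lia.
by rewrite rw; case: eqP => // e; lia.
Qed.

Lemma wedge_stable n w m : frame w -> (size m <= n)%N ->
  wedge w m = wedge_minor n w m.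
Proof.
move=> fw hn; rewrite /wedge -(subnKC hn); elim: (n - size m)%N => [|d IH].
  by rewrite addn0.
rewrite addnS wedge_minorS_row; last first.
  by move=> b hb; rewrite smon_ix_tail ?leq_addr //; apply: (fw b).2; lia.
by rewrite smon_ix_tail ?leq_addr // (fw _).1 mul1r.
Qed.

Lemma ext_wedge n w (T : 'I_n -> int) : frame w -> ext (wedge w) T = tuple_minor w T.
Proof.
move=> fw; have [[a ha]|hlow] := pselect (exists a, T a <= - n%:Z).
  rewrite (ext_low _ ha) (@tuple_minor_row0 _ _ _ _ a) // => b hb.
  by apply: (fw b).2; lia.
have [injT|ninj] := pselect (injective T); last first.
  have [a [a' [naa e]]] : exists a a', a != a' /\ T a = T a'.
    apply: contrapT => h; apply: ninj => a a' e; apply: contrapT => /eqP naa.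
    by apply: h; exists a, a'.
  by rewrite (ext_eq0 _ naa e) (tuple_minor_eq _ naa e).
have {}hlow a : - n%:Z < T a by rewrite ltNge; apply/negP => h; apply: hlow; exists a.
have [m [sg [hm /funext ->]]] := smon_of_tuple injT hlow.
pose S : 'I_n -> int := fun a => smon_ix m a.
rewrite (ext_perm _ S) (tuple_minor_perm _ S) ext_smon //.
by rewrite (wedge_stable fw hm) tuple_minor_smon.
Qed.

(** The coordinates at [-b] show that the change of basis has diagonal 1, so its finite corners have
    determinant 1. *)
Lemma wedge_triangular w w' (u : nat -> nat -> K) : frame w -> frame w' ->
  (forall b x, w' b x = \sum_(c < b.+1) u c b * w c x) -> wedge w' = wedge w.
Proof.
move=> fw fw' h; apply/funext => m; rewrite /wedge /wedge_minor.
have hd b : u b b = 1.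
  have := h b (- b%:Z); rewrite (fw' b).1 big_ord_recr /= (fw b).1 mulr1.
  by rewrite big1 ?add0r // => c _; rewrite (fw c).2 ?mulr0 //; have := ltn_ord c; lia.
pose U : 'M[K]_(size m) := \matrix_(c, b) (if (c <= b)%N then u c b else 0).
rewrite (_ : \matrix_(a, b) _ = (\matrix_(a, b) (w b (smon_ix m a) : K)) *m U); last first.
  apply/matrixP=> a b; rewrite !mxE h.
  rewrite (big_ord_widen _ (fun c => u c b * w c (smon_ix m a)) (ltn_ord b)).
  rewrite big_mkcond; apply: eq_bigr => c _; rewrite !mxE ltnS.
  by case: ifP; rewrite ?mulr0 // mulrC.
rewrite det_mulmx; suff -> : \det U = 1 by rewrite mulr1.
rewrite -det_tr det_trig; last first.
  by apply/is_trig_mxP => i j hij; rewrite !mxE leqNgt hij.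
by rewrite big1 // => i _; rewrite !mxE leqnn.
Qed.

(** [G] acts on vectors with infinitely many coordinates through the rows of [A]; the window
    suffices once [f] vanishes on the part of the row below it. *)
Definition op_matrix L A G := forall f i n M, i + L%:Z <= M%:Z ->
  (forall j, i - L%:Z <= j -> j <= - n%:Z -> f j = 0) ->
  G f i = \sum_(x < n + M) A i (win n x) * f (win n x).

(** For a reduced frame the coefficients of an expansion are the coordinates at nonpositive indices,
    so they need not be quantified. *)
Definition in_plane w (f : vect K) :=
  exists n : nat, forall x, f x = \sum_(c < n) f (- c%:Z) * w c x.

Lemma in_plane_widen w f n : reduced w -> in_plane w f ->
  (forall c, (n <= c)%N -> f (- c%:Z) = 0) ->
  forall x, f x = \sum_(c < n) f (- c%:Z) * w c x.
Proof.
move=> rw [n0 h0] hz x.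
have hz0 c : (n0 <= c)%N -> f (- c%:Z) = 0.
  move=> hc; rewrite h0 big1 // => d _; rewrite rw.
  by have := ltn_ord d; case: eqP => [e|_]; [lia|rewrite mulr0].
pose F c := f (- c%:Z) * w c x.
have wid k k' : (k <= k')%N -> (forall c, (k <= c)%N -> f (- c%:Z) = 0) ->
    \sum_(c < k) F c = \sum_(c < k') F c.
  move=> hk hzk; rewrite (big_ord_widen _ F hk) big_mkcond; apply: eq_bigr => c _.
  by case: ltnP => // hc; rewrite /F hzk ?mul0r.
rewrite h0 -/(F _) (wid n0 (maxn n n0)) ?leq_maxr // (wid n (maxn n n0)) ?leq_maxl //.
Qed.

(** Row replacements in the minor, summed against cofactors, become column replacements of [w b] by
    [G (w b)]. By [adj M * M = det M] only the component of [G (w b)] along [w b] survives. For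
    [k >= L] the band of row [-k] stays at nonpositive indices, where [w k] is a unit vector; this
    component is then the diagonal entry of [A], and the trace stops at [L]. *)
Lemma rhat_wedge L A G w : banded L A -> op_matrix L A G -> reduced w ->
  (forall b, in_plane w (G (w b))) ->
  rhat A (wedge w)
  = (\sum_(k < L) (G (w k) (- k%:Z) - A (- k%:Z) (- k%:Z))) *: wedge w.
Proof.
move=> bA hG rw stab; have fw := reduced_frame rw.
apply/funext => m; pose n := (size m + L)%N.
pose M := (absz (smon_ix m 0) + L)%N; have h0 := smon_ix_ge m 0.
have hM : smon_ix m 0 + L%:Z <= M%:Z by rewrite /M; lia.
pose S : 'I_n -> int := fun a => smon_ix m a.
have hm : (size m <= n)%N by apply: leq_addr.
have Gz b c : (b + L < c)%N -> G (w b) (- c%:Z) = 0.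
  move=> hbc; rewrite (hG (w b) (- c%:Z) (c + L).+1 L).
  - rewrite big1 // => x _.
    have [->|/bA hA] := eqVneq (A (- c%:Z) (win (c + L).+1 x)) 0; first by rewrite mul0r.
    by rewrite (fw b).2 ?mulr0 //; lia.
  - lia.
  - by move=> j h1 h2; apply: (fw b).2; lia.
rewrite (rhat_band _ bA (leqnn n) hM) -/S.
pose Mw : 'M[K]_n := \matrix_(a, b) (w b (S a) : K).
have dM : \det Mw = wedge w m by rewrite (wedge_stable fw hm).
have -> : opn M A (@ext K n (wedge w)) S
    = \sum_(b < n) \sum_(c < n + L) G (w b) (- c%:Z) *
        \sum_(a < n) w c (S a) * cofactor Mw a b.
  transitivity (\sum_(a < n) \sum_(b < n) G (w b) (S a) * cofactor Mw a b).
    apply: eq_bigr => a _.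
    under eq_bigr do rewrite ext_wedge // tuple_minor_upd big_distrr.
    rewrite exchange_big; apply: eq_bigr => b _ /=.
    rewrite (hG (w b) (S a) n M); first last.
    - by move=> j _ hj; apply: (fw b).2; have := ltn_ord b; lia.
    - by have := smon_ix_le m a; rewrite /S; lia.
    by rewrite big_distrl; apply: eq_bigr => x _ /=; rewrite mulrA.
  rewrite exchange_big; apply: eq_bigr => b _.
  transitivity (\sum_(a < n) \sum_(c < n + L)
      G (w b) (- c%:Z) * (w c (S a) * cofactor Mw a b)).
    apply: eq_bigr => a _; rewrite (in_plane_widen rw (stab b) (n := n + L)).
      by rewrite big_distrl; apply: eq_bigr => c _ /=; rewrite mulrA.
    by move=> c hc; apply: Gz; have := ltn_ord b; lia.
  by rewrite exchange_big; apply: eq_bigr => c _; rewrite big_distrr.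
have inner (b : 'I_n) (c : nat) : (c < n + L)%N ->
    G (w b) (- c%:Z) * (\sum_(a < n) w c (S a) * cofactor Mw a b)
    = (c == b)%:R * (G (w b) (- c%:Z) * wedge w m).
  move=> hc; case: (ltnP c n) => hcn.
    have hs : \sum_(a < n) w c (S a) * cofactor Mw a b = (c == b)%:R * wedge w m.
      have := mul_adj_mx Mw => /matrixP/(_ b (Ordinal hcn)); rewrite !mxE dM.
      rewrite -[b == _]/(nat_of_ord b == c) [c == b :> nat]eq_sym mulr_natl => <-.
      by apply: eq_bigr => a _; rewrite !mxE mulrC.
    by rewrite hs mulrCA.
  (* For [c >= n] the index [b] lies in the tail of [m], and row [b] is the unit vector of column
     [b]. Its own term has [w c] vanishing at [-b]; every other cofactor contains a zero row. *)
  have [e0|nz] := eqVneq (G (w b) (- c%:Z)) 0; first by rewrite e0 !mul0r mulr0.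
  have hb : (c <= b + L)%N.
    by rewrite leqNgt; apply/negP => /Gz e; rewrite e eqxx in nz.
  have -> : (c == b) = false by have := ltn_ord b; case: eqP => //; lia.
  rewrite mul0r big1 ?mulr0 // => a _.
  have Sb : S b = - b%:Z by apply: smon_ix_tail; lia.
  have [->|nab] := eqVneq a b.
    by rewrite Sb rw; have := ltn_ord b; case: eqP => [e|_]; [lia|rewrite mul0r].
  rewrite (@cofactor_row0 _ _ _ _ _ b) ?mulr0 // 1?eq_sym // => b' nb.
  by rewrite mxE Sb rw -[b' == b :> nat]/(b' == b) (negPf nb).
under eq_bigr => b _ do under eq_bigr => c _ do rewrite inner ?ltn_ord //.
have -> : \sum_(b < n) \sum_(c < n + L) (c == b :> nat)%:R * (G (w b) (- c%:Z) * wedge w m)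
    = (\sum_(b < n) G (w b) (- b%:Z)) * wedge w m.
  rewrite big_distrl; apply: eq_bigr => b _ /=.
  have hb : (b < n + L)%N by have := ltn_ord b; lia.
  rewrite (bigD1 (Ordinal hb)) //= eqxx mul1r big1 ?addr0 // => c nc.
  by case: eqP => [e|]; rewrite ?mul0r //; case/eqP: nc; apply: val_inj.
rewrite -mulrBl -sumrB -[RHS]/(_ * wedge w m); congr (_ * _).
pose F k := G (w k) (- k%:Z) - A (- k%:Z) (- k%:Z).
rewrite -/(F _) [RHS](big_ord_widen n F) ?leq_addl // [RHS]big_mkcond.
apply: eq_bigr => k _; case: ltnP => // hk; rewrite /F.
rewrite (hG (w k) (- k%:Z) (k + L).+1 L); first last.
- by move=> j h1 h2; apply: (fw k).2; lia.
- by lia.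
apply/eqP; rewrite subr_eq0; apply/eqP.
rewrite -[RHS](@sum_win _ (k + L).+1 L (- k%:Z) (fun j => A (- k%:Z) j)); try lia.
apply: eq_bigr => x _.
have [->|/bA hA] := eqVneq (A (- k%:Z) (win (k + L).+1 x)) 0; first by rewrite !mul0r.
congr (_ * _); have hx : win (k + L).+1 x = - (absz (win (k + L).+1 x))%:Z by lia.
by rewrite hx rw eqr_opp eqz_nat eq_sym.
Qed.

End Wedges.

(** * Differential operators *)

Section DiffOps.
Variables (K : numFieldType) (N : nat) (s : K).
Implicit Types (f g : vect K) (p q : {poly K}) (k l : int).
Local Notation D := (Dact N s).
Local Notation Z := (@zact K N).
Local Notation diffop := (diffop N s).
Local Notation diffop_mx := (diffop_mx N s).
Local Notation rhat_op := (rhat_op N s).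

Lemma Dact_linear (c : K) f g : D (c *: f + g) = c *: D f + D g.
Proof.
apply/funext => i; rewrite /Dact -[RHS]/(c * D f i + D g i) /Dact.
rewrite -![(c *: f + g) _]/(c * f _ + g _); ring.
Qed.

Lemma iter_Dact_linear n (c : K) f g :
  iter n D (c *: f + g) = c *: iter n D f + iter n D g.
Proof. by elim: n => //= n ->; rewrite Dact_linear. Qed.

Definition pD p f : vect K := \sum_(i < size p) p`_i *: iter i D f.

Lemma diffopE k p f : diffop k p f = Z k (pD p f). Proof. by []. Qed.

Lemma pD_widen n p f : (size p <= n)%N -> pD p f = \sum_(i < n) p`_i *: iter i D f.
Proof.
move=> h; rewrite /pD (big_ord_widen _ (fun i => p`_i *: iter i D f) h) big_mkcond.
by apply: eq_bigr => i _; case: ltnP => // hi; rewrite nth_default // scale0r.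
Qed.

Lemma pD_linear_p (c : K) p q f : pD (c *: p + q) f = c *: pD p f + pD q f.
Proof.
pose n := maxn (size p) (size q).
have hpq : (size (c *: p + q)%R <= n)%N.
  by rewrite (leq_trans (size_polyD _ _)) // geq_max leq_maxr
    (leq_trans (size_scale_leq _ _)) ?leq_maxl.
rewrite (pD_widen _ hpq) !(@pD_widen n) ?leq_maxl ?leq_maxr //.
rewrite scaler_sumr -big_split; apply: eq_bigr => i _ /=.
by rewrite coefD coefZ scalerDl scalerA.
Qed.

Lemma pD_linear p (c : K) f g : pD p (c *: f + g) = c *: pD p f + pD p g.
Proof.
rewrite /pD scaler_sumr -big_split; apply: eq_bigr => i _ /=.
by rewrite iter_Dact_linear scalerDr !scalerA mulrC.
Qed.

Lemma pDD p f g : pD p (f + g) = pD p f + pD p g.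
Proof. by have := pD_linear p 1 f g; rewrite !scale1r. Qed.

Lemma pD_addp p q f : pD (p + q) f = pD p f + pD q f.
Proof. by have := pD_linear_p 1 p q f; rewrite !scale1r. Qed.

Lemma pD0 f : pD 0 f = 0.
Proof. by rewrite /pD size_poly0 big_ord0. Qed.

Lemma pD_scale (c : K) p f : pD (c *: p) f = c *: pD p f.
Proof. by have := pD_linear_p c p 0 f; rewrite pD0 !addr0. Qed.

Lemma pDC (c : K) f : pD c%:P f = c *: f.
Proof.
by rewrite (@pD_widen 1) ?size_polyC_leq1 // big_ord1 coefC.
Qed.

Lemma pD_Xn n f : pD 'X^n f = iter n D f.
Proof.
rewrite /pD size_polyXn big_ord_recr /= big1 ?add0r => [|i _].
  by rewrite coefXn eqxx scale1r.
by rewrite coefXn (ltn_eqF (ltn_ord i)) scale0r.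
Qed.

Lemma pDX f : pD 'X f = D f.
Proof. exact: (pD_Xn 1). Qed.

Lemma pD_mulX p f : pD (p * 'X) f = pD p (D f).
Proof.
have hs : (size (p * 'X)%R <= (size p).+1)%N.
  by rewrite (leq_trans (size_polyMleq _ _)) // size_polyX addnC.
rewrite (pD_widen _ hs) big_ord_recl coefMX eqxx scale0r add0r.
apply: eq_bigr => i _; rewrite coefMX /=; congr (_ *: _).
by rewrite -iterS iterSr.
Qed.

Lemma Dact0 : D 0 = 0.
Proof.
apply/funext => i; rewrite /Dact -[0 (i + 1)]/(0 : K) -[0 i]/(0 : K).
by rewrite mulr0 addr0.
Qed.

Lemma pD_Dact p f : pD p (D f) = D (pD p f).
Proof.
have DD g h : D (g + h) = D g + D h.
  by have := Dact_linear 1 g h; rewrite !scale1r.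
rewrite /pD (big_morph D DD Dact0); apply: eq_bigr => i _.
have := Dact_linear p`_i (iter i D f) 0; rewrite Dact0 !addr0 => ->.
by rewrite -iterS iterSr.
Qed.

Lemma pDM p q f : pD (p * q) f = pD p (pD q f).
Proof.
elim/poly_ind: p q f => [|p c IH] q f; first by rewrite mul0r !pD0.
rewrite mulrDl -mulrA !pD_addp IH mul_polyC pD_scale pDC pD_mulX; congr (pD p _ + _).
by rewrite mulrC pD_mulX pD_Dact.
Qed.

Lemma zact0 f : Z 0 f = f.
Proof. by apply/funext => i; rewrite /zact mul0r addr0. Qed.

Lemma zactD k l f : Z k (Z l f) = Z (k + l) f.
Proof. by apply/funext => i; rewrite /zact mulrDl addrA. Qed.

Lemma diffop_linear k p (c : K) f g :
  diffop k p (c *: f + g) = c *: diffop k p f + diffop k p g.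
Proof. by rewrite !diffopE pD_linear. Qed.

Lemma diffop_linear_p k (c : K) p q f :
  diffop k (c *: p + q) f = c *: diffop k p f + diffop k q f.
Proof. by rewrite !diffopE pD_linear_p. Qed.

Lemma diffopB_p k p q f : diffop k (p - q) f = diffop k p f - diffop k q f.
Proof. by rewrite addrC -scaleN1r diffop_linear_p scaleN1r addrC. Qed.

Lemma iter_Dact_local n f g i :
  (forall j, i <= j -> j <= i + n%:Z -> f j = g j) -> iter n D f i = iter n D g i.
Proof.
elim: n i => [|n IH] i h /=; first by apply: h; lia.
by rewrite /Dact !IH // => j h1 h2; apply: h; lia.
Qed.

Lemma iter_Dact_lead n f j : (forall x, x < j -> f x = 0) ->
  iter n D f (j - n%:Z) = f j.
Proof.
move=> hf; elim: n => [|n IH] /=; first by rewrite subr0.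
have -> : j - n.+1%:Z = j - n%:Z - 1 by lia.
rewrite /Dact subrK IH (@iter_Dact_local n f 0).
  have -> : iter n D 0 = 0 by elim: n {IH} => //= n ->; apply: Dact0.
  by rewrite mulr0 addr0.
by move=> x h1 h2; apply: hf; lia.
Qed.

(** Only the top power of [D] lowers the index by [deg p], each step with coefficient 1. Minimality
    of the characteristic polynomials rests on this entry. *)
Lemma diffop_mx_lead k p j :
  diffop_mx k p (j - (size p).-1%:Z - k * N%:Z) j = lead_coef p.
Proof.
rewrite /diffop_mx diffopE /zact subrK /pD fct_sumE.
have [->|p0] := eqVneq p 0; first by rewrite size_poly0 big_ord0 lead_coef0.
have hs : (0 < size p)%N by rewrite size_poly_gt0.
have vd n : iter n D (vdelta K j) (j - n%:Z) = 1.
  rewrite iter_Dact_lead /vdelta ?eqxx // => x hx.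
  by case: eqP => // e; move: hx; rewrite e ltxx.
rewrite -(prednK hs) big_ord_recr /= big1 ?add0r => [|i _].
  by rewrite -[LHS]/(p`_(size p).-1 * iter (size p).-1 D (vdelta K j) _) vd mulr1.
rewrite -[LHS]/(p`_i * iter i D (vdelta K j) _) (@iter_Dact_local i _ 0).
  have -> : iter i D 0 = 0 by elim: (nat_of_ord i) => //= n ->; apply: Dact0.
  by rewrite mulr0.
move=> x h1 h2; rewrite /vdelta; case: eqP => // e.
by have := ltn_ord i; lia.
Qed.

Lemma diffop_local k p f g i :
  (forall j, i + k * N%:Z <= j -> j <= i + k * N%:Z + (size p).-1%:Z -> f j = g j) ->
  diffop k p f i = diffop k p g i.
Proof.
move=> h; rewrite !diffopE /zact /pD !fct_sumE; apply: eq_bigr => l _.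
congr (_ * _); apply: iter_Dact_local => j h1 h2; apply: h => //.
by have := ltn_ord l; lia.
Qed.

Lemma diffop0 k p : diffop k p 0 = 0.
Proof. by have := diffop_linear k p (-1) 0 0; rewrite scaler0 addr0 scaleN1r addNr. Qed.

Lemma diffop_mx_supp k p i j : diffop_mx k p i j != 0 ->
  (i + k * N%:Z <= j) && (j <= i + k * N%:Z + (size p).-1%:Z).
Proof.
apply: contraR => h; apply/eqP.
rewrite -[RHS]/((0 : vect K) i) -(diffop0 k p); apply: diffop_local => j' h1 h2.
by rewrite /vdelta; case: eqP => // e; move: h; rewrite -e h1 h2.
Qed.

Lemma diffop_sum k p (I : finType) (c : I -> K) (F : I -> vect K) :
  diffop k p (\sum_i c i *: F i) = \sum_i c i *: diffop k p (F i).
Proof.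
have dD g h : diffop k p (g + h) = diffop k p g + diffop k p h.
  by have := diffop_linear k p 1 g h; rewrite !scale1r.
rewrite (big_morph _ dD (diffop0 k p)); apply: eq_bigr => i _.
by have := diffop_linear k p (c i) (F i) 0; rewrite diffop0 !addr0.
Qed.

Definition width k p : nat := (absz k * N + size p)%N.

Lemma diffop_banded L k p : (width k p <= L)%N -> banded L (diffop_mx k p).
Proof.
move=> hL i j /diffop_mx_supp.
have : `|k * N%:Z| = (absz k * N)%N%:Z by rewrite normrM PoszM.
by move: hL; rewrite /width; lia.
Qed.

Lemma diffop_op_matrix L k p : (width k p <= L)%N ->
  op_matrix L (diffop_mx k p) (diffop k p).
Proof.
move=> hL f i n M hM hf; have hk : `|k * N%:Z| = (absz k * N)%N%:Z by rewrite normrM PoszM.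
pose fw : vect K := \sum_(x < n + M) f (win n x) *: vdelta K (win n x).
have -> : diffop k p f i = diffop k p fw i.
  apply: diffop_local => j h1 h2; rewrite /fw fct_sumE.
  under eq_bigr do rewrite -[(_ *: _) j]/(f _ * (j == _)%:R) eq_sym.
  rewrite /width in hL; have [hj|hj] := lerP j (- n%:Z).
    rewrite hf ?big1 //; last by lia.
    by move=> x _; have := win_gt n x; case: eqP => [e|]; rewrite ?mulr0 //; lia.
  by rewrite sum_win // => _; lia.
rewrite /fw diffop_sum fct_sumE; apply: eq_bigr => x _.
by rewrite -[LHS]/(_ * _) mulrC.
Qed.

Lemma rhat_op_linear k p (c : K) u v :
  rhat_op k p (c *: u + v) = c *: rhat_op k p u + rhat_op k p v.
Proof. exact: (rhat_linear _ _ _ (diffop_banded (leqnn (width k p)))). Qed.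

Lemma rhat_op_linear_p k (c : K) p q v :
  rhat_op k (c *: p + q) v = c *: rhat_op k p v + rhat_op k q v.
Proof.
pose L := (width k p + width k q)%N.
have hp := diffop_banded (leq_addr (width k q) (width k p)).
have hq := diffop_banded (leq_addl (width k p) (width k q)).
rewrite /rhat_op -(rhat_linear_mx c v hp hq); congr rhat.
by apply/funext => i; apply/funext => j; rewrite /diffop_mx diffop_linear_p.
Qed.

Hypothesis N_gt0 : (0 < N)%N.

(** The polynomial [p(D + k)], from [D z^k = z^k (D + k)]. *)
Definition shiftp (k : int) p : {poly K} := p \Po ('X + (k%:~R)%:P).

Lemma shiftpK k p : shiftp k (shiftp (- k) p) = p.
Proof.
rewrite /shiftp -comp_polyA comp_polyD comp_polyX comp_polyC -addrA -polyCD.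
by rewrite intrN addrN addr0 comp_polyXr.
Qed.

Lemma Dact_zact k f : D (Z k f) = Z k (pD ('X + (k%:~R)%:P) f).
Proof.
rewrite pD_addp pDX pDC; apply/funext => i.
rewrite /Dact /zact -[RHS]/(f (i + k * N%:Z + 1) +
  (s - (i + k * N%:Z)%:~R) / N%:R * f (i + k * N%:Z) + k%:~R * f (i + k * N%:Z)).
rewrite [i + 1 + _]addrAC -[RHS]addrA -[X in _ = _ + X]mulrDl; congr (_ + _ * _).
rewrite intrD intrM /=.
by field; rewrite pnatr_eq0 -lt0n.
Qed.

Lemma pD_zact p k f : pD p (Z k f) = Z k (pD (shiftp k p) f).
Proof.
rewrite /shiftp; elim/poly_ind: p f => [|p c IH] f.
  by rewrite comp_poly0 !pD0.
rewrite comp_polyD comp_polyM comp_polyX comp_polyC !pD_addp !pDC pD_mulX.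
by rewrite Dact_zact IH pDM.
Qed.

Lemma diffopM k l p q f :
  diffop k p (diffop l q f) = diffop (k + l) (shiftp l p * q) f.
Proof. by rewrite !diffopE pD_zact zactD pDM. Qed.

(** The polynomial part of the commutator of [z^k p(D)] and [z^l q(D)], whose power of [z] is
    [k + l]. *)
Definition bracket k l p q : {poly K} := shiftp l p * q - shiftp k q * p.

Lemma size_bracket k l p q : (size (bracket k l p q) <= size p + size q)%N.
Proof.
have hc r l' : size (shiftp l' r) = size r.
  by rewrite /shiftp size_comp_poly2 // size_XaddC.
rewrite /bracket (leq_trans (size_polyD _ _)) // size_polyN geq_max.
apply/andP; split; apply: (leq_trans (size_polyMleq _ _)); rewrite hc.
  exact: leq_pred.
by rewrite [(size p + _)%N]addnC leq_pred.
Qed.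

Lemma rhat_op_comm k l p q : exists c : K, forall v,
  rhat_op k p (rhat_op l q v) - rhat_op l q (rhat_op k p v)
  = rhat_op (k + l) (bracket k l p q) v + c *: v.
Proof.
pose L := (width k p + width l q)%N.
have hp : (width k p <= L)%N by apply: leq_addr.
have hq : (width l q <= L)%N by apply: leq_addl.
apply: (@rhat_comm _ L); try exact: diffop_banded.
  apply: diffop_banded; have := size_bracket k l p q.
  by rewrite /L /width; nia.
move=> n M i j h1 h2; rewrite /mxwin.
rewrite -(diffop_op_matrix hp (f := diffop l q (vdelta K j))) //; last by move=> j'; lia.
rewrite -(diffop_op_matrix hq (f := diffop k p (vdelta K j))) //; last by move=> j'; lia.
by rewrite !diffopM [l + k]addrC /diffop_mx /bracket diffopB_p.
Qed.

End DiffOps.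

(** * The representation W on the Fock space *)

Section Vacuum.
Variable K : numFieldType.
Implicit Types (m : smon) (A : int -> int -> K).
Local Notation vac := (ket K smon_vac).

Lemma ext_vac_pos n (T : 'I_n -> int) a : 0 < T a -> ext vac T = 0.
Proof.
move=> h; rewrite /ext /ket; case: eqP => [->|]; last by rewrite mulr0.
rewrite (@tuple_minor_row0 _ _ _ _ a) ?mul0r // => b _.
by rewrite /monoms /vdelta smon_ix_tail //; case: eqP => // e; lia.
Qed.

(** Strictly lowered factors land on filled positions, and the diagonal terms are cancelled by
    normal ordering. *)
Lemma rhat_lowering_vac L A : banded L A -> (forall i j, A i j != 0 -> i <= j) ->
  rhat A vac = 0.
Proof.
move=> bA lA; apply/funext => m; pose n := (size m + L)%N.
pose M := (absz (smon_ix m 0) + L)%N; have h0 := smon_ix_ge m 0.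
have hM : smon_ix m 0 + L%:Z <= M%:Z by rewrite /M; lia.
rewrite (rhat_band _ bA (leqnn n) hM) -[RHS]/(0 : K) /opn.
have [sm|sm] := posnP (size m); last first.
  rewrite [X in _ - _ * X](_ : _ = 0); last first.
    by rewrite /ket; case: eqP => // e; move: sm; rewrite e.
  rewrite mulr0 subr0 big1 // => a _; rewrite big1 // => x _.
  have [->|/lA hx] := eqVneq (A (smon_ix m a) (win n x)) 0; first by rewrite mul0r.
  have n0 : (0 < n)%N by rewrite /n; lia.
  have hp := smon_ix_head sm.
  rewrite (@ext_vac_pos _ _ (Ordinal n0)) ?mulr0 // /upd.
  case: eqP => [e|_] //=; by move: hx; rewrite -e /=; lia.
have -> : m = smon_vac by apply: val_inj; apply: size0nil.
rewrite /ket eqxx mulr1 -sumrB big1 // => a _.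
rewrite -[X in _ - X](@sum_win _ n M (- a%:Z) (fun j => A (- a%:Z) j)); first last.
- by lia.
- by have := ltn_ord a; lia.
rewrite -sumrB big1 // => x _; rewrite smon_ix_tail // -mulrBr.
have [hx|hx] := lerP (win n x) 0.
  rewrite (@ext_upd_low _ _ _ smon_vac) ?win_gt // smon_ix_tail //.
  by rewrite /ket eqxx mulr1 subrr mulr0.
rewrite (@ext_vac_pos _ _ a) ?/upd ?eqxx //.
by case: eqP => [e|_]; [lia | rewrite subrr mulr0].
Qed.

End Vacuum.

(** * Commutators of the operators W *)

Section WFock.
Variables (K : numFieldType) (N : nat) (s : K).
Hypothesis N_gt0 : (0 < N)%N.
Implicit Types (v : fock K) (p q : {poly K}) (k l : int).
Local Notation W := (W_fock N s).
Local Notation rhat_op := (rhat_op N s).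
Local Notation gamma := (gamma N s).

Lemma bracket0X k p : bracket 0 k 'X p = k%:~R *: p.
Proof.
rewrite /bracket /shiftp comp_polyX addr0 comp_polyXr mulrDl mulrC.
by rewrite addrC addKr mul_polyC.
Qed.

Lemma rhat_op_scale k (c : K) p v : rhat_op k (c *: p) v = c *: rhat_op k p v.
Proof.
have e0 : rhat_op k 0 v = 0.
  by have := rhat_op_linear_p N s k (-1) 0 0 v; rewrite scaler0 addr0 scaleN1r addNr.
by have := rhat_op_linear_p N s k c p 0 v; rewrite e0 !addr0.
Qed.

Lemma gamma_linear k (c : K) p q :
  gamma k (c *: p + q) = c * gamma k p + gamma k q.
Proof.
rewrite /gamma; case: ifP => _; first by rewrite mulr0 addr0.
case: ifP => _.
  pose n := maxn (size p) (size q).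
  have hpq : (size (c *: p + q)%R <= n)%N.
    by rewrite (leq_trans (size_polyD _ _)) // geq_max leq_maxr
      (leq_trans (size_scale_leq _ _)) ?leq_maxl.
  have wid (r : {poly K}) : (size r <= n)%N ->
      \sum_(i < size r) r`_i * gamma_D N s i = \sum_(i < n) r`_i * gamma_D N s i.
    move=> h; rewrite (big_ord_widen _ (fun i => r`_i * gamma_D N s i) h) big_mkcond.
    by apply: eq_bigr => i _; case: ltnP => // hi; rewrite nth_default // mul0r.
  rewrite !wid ?leq_maxl ?leq_maxr // big_distrr -big_split; apply: eq_bigr => i _ /=.
  by rewrite coefD coefZ; ring.
rewrite !rhat_op_linear_p !rhat_op_linear.
set d := rhat_op k p _; set d' := rhat_op k q _.
set a := rhat_op 0 'X d; set a' := rhat_op 0 'X d'.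
set b := rhat_op k p _; set b' := rhat_op k q _.
pose ki : K := k%:~R^-1; rewrite -/ki.
rewrite -[LHS]/(ki * ((c * a smon_vac + a' smon_vac) - (c * b smon_vac + b' smon_vac))
  - (c * d smon_vac + d' smon_vac)).
rewrite -[RHS]/(c * (ki * (a smon_vac - b smon_vac) - d smon_vac)
  + (ki * (a' smon_vac - b' smon_vac) - d' smon_vac)).
ring.
Qed.

Lemma W_fock_linear_p k (c : K) p q v : W k (c *: p + q) v = c *: W k p v + W k q v.
Proof.
rewrite /W_fock rhat_op_linear_p gamma_linear scalerDl scalerDr scalerA.
by rewrite addrACA.
Qed.

Lemma W_fockN k p v : W k (- p) v = - W k p v.
Proof.
have e0 : W k 0 v = 0.
  by have := W_fock_linear_p k (-1) 0 0 v; rewrite scaler0 addr0 scaleN1r addNr.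
by have := W_fock_linear_p k (-1) p 0 v; rewrite e0 !addr0 !scaleN1r.
Qed.

Lemma W_fock_linear k p (c : K) u v : W k p (c *: u + v) = c *: W k p u + W k p v.
Proof.
rewrite /W_fock rhat_op_linear !scalerDr !scalerA addrACA.
by rewrite [gamma k p * c]mulrC.
Qed.

Lemma W_fock_rhat_comm k l p q v :
  W k p (W l q v) - W l q (W k p v)
  = rhat_op k p (rhat_op l q v) - rhat_op l q (rhat_op k p v).
Proof.
rewrite {1 3}/W_fock ![W _ _ v]/W_fock.
have e1 k' p' (c : K) u u' : rhat_op k' p' (u + c *: u') = rhat_op k' p' u + c *: rhat_op k' p' u'.
  by rewrite addrC rhat_op_linear addrC.
rewrite !e1 !scalerDr !scalerA [gamma l q * _]mulrC.
set x := rhat_op k p v; set y := rhat_op l q v; set a := rhat_op k p y; set b := rhat_op l q x.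
apply/funext => m; rewrite -[RHS]/(a m - b m).
set gk := gamma k p; set gl := gamma l q.
rewrite -[LHS]/((a m + gl * x m + (gk * y m + gk * gl * v m))
   - (b m + gk * y m + (gl * x m + gk * gl * v m))).
ring.
Qed.

Lemma W_fock_comm k l p q : exists c : K, forall v,
  W k p (W l q v) - W l q (W k p v) = W (k + l) (bracket k l p q) v + c *: v.
Proof.
have [c hc] := rhat_op_comm s N_gt0 k l p q.
exists (c - gamma (k + l) (bracket k l p q)) => v.
rewrite W_fock_rhat_comm hc /W_fock scalerBl -addrA; congr (_ + _).
by rewrite addrC subrK.
Qed.

(* For k < 0 the scalar gamma is by definition 1/k times the central term of
   [rhat(D), rhat(z^k p)]; for k > 0 both operators kill the vacuum, so that this
   central term vanishes. *)
Lemma W_fock_D k p v : k != 0 ->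
  W 0 'X (W k p v) - W k p (W 0 'X v) = k%:~R *: W k p v.
Proof.
move=> k0; have kK : k%:~R != 0 :> K by rewrite intr_eq0.
have [c hc] := rhat_op_comm s N_gt0 0 k 'X p.
suff cE : c = k%:~R * gamma k p.
  rewrite W_fock_rhat_comm hc add0r bracket0X rhat_op_scale cE /W_fock.
  by rewrite scalerDr scalerA.
have lowD : rhat_op 0 'X (ket K smon_vac) = 0.
  rewrite /rhat_op; apply: rhat_lowering_vac; first exact: diffop_banded (leqnn _).
  by move=> i j /diffop_mx_supp; rewrite mul0r addr0 => /andP[].
have hv := hc (ket K smon_vac); move: hv; rewrite add0r bracket0X rhat_op_scale.
rewrite /gamma; case: (ltgtP k 0) k0 => // hk _.
  set x := rhat_op k p (ket K smon_vac); set y := rhat_op 0 'X (ket K smon_vac).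
  move=> /(congr1 (fun f => f smon_vac)).
  rewrite -[X in X = _ -> _]/(rhat_op 0 'X x smon_vac - rhat_op k p y smon_vac).
  rewrite -[X in _ = X -> _]/(k%:~R * x smon_vac + c * ket K smon_vac smon_vac) => e.
  rewrite -[X in _ = _ * X]/(k%:~R^-1 * (rhat_op 0 'X x smon_vac - rhat_op k p y smon_vac)
    - x smon_vac) e.
  by rewrite /ket eqxx mulr1 mulrBr mulrA mulfV // mul1r addrAC subrr add0r.
have lowk : rhat_op k p (ket K smon_vac) = 0.
  rewrite /rhat_op; apply: rhat_lowering_vac; first exact: diffop_banded (leqnn _).
  by move=> i j /diffop_mx_supp /andP[h _]; apply: le_trans h; rewrite lerDl; nia.
have r0 k' p' : rhat_op k' p' 0 = 0.
  by have := rhat_op_linear N s k' p' (-1) 0 0; rewrite scaler0 addr0 scaleN1r addNr.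
rewrite lowD lowk !r0 subrr scaler0 add0r mulr0 => /(congr1 (fun f => f smon_vac)).
by rewrite -[RHS]/(c * ket K smon_vac smon_vac) /ket eqxx mulr1 => <-.
Qed.

End WFock.

(** * The Bessel plane *)

Section Plane.
Variable K : numFieldType.
Implicit Types (w : nat -> vect K) (f g : vect K).

Lemma in_plane_frame w k : reduced w -> in_plane w (w k).
Proof.
move=> rw; exists k.+1 => x; rewrite big_ord_recr /= rw eqxx mul1r big1 ?add0r // => c _.
by rewrite rw (gtn_eqF (ltn_ord c)) mul0r.
Qed.

Lemma in_plane_low w f : reduced w -> in_plane w f ->
  exists n : nat, forall c, (n <= c)%N -> f (- c%:Z) = 0.
Proof.
move=> rw [n h]; exists n => c hc; rewrite h big1 // => d _; rewrite rw.
by have := ltn_ord d; case: eqP => [e|_]; [lia|rewrite mulr0].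
Qed.

Lemma in_plane_linear w (c : K) f g : reduced w -> in_plane w f -> in_plane w g ->
  in_plane w (c *: f + g).
Proof.
move=> rw hf hg; have [n1 h1] := in_plane_low rw hf; have [n2 h2] := in_plane_low rw hg.
exists (maxn n1 n2) => x; rewrite -[LHS]/(c * f x + g x).
rewrite (in_plane_widen rw hf (n := maxn n1 n2)); last first.
  by move=> d; rewrite geq_max => /andP[hd _]; apply: h1.
rewrite (in_plane_widen rw hg (n := maxn n1 n2)); last first.
  by move=> d; rewrite geq_max => /andP[_ hd]; apply: h2.
rewrite big_distrr -big_split; apply: eq_bigr => d _ /=.
by rewrite -[(c *: f + g) _]/(c * f _ + g _); ring.
Qed.

Lemma in_plane0 w : in_plane w (0 : vect K).
Proof. by exists 0%N => x; rewrite big_ord0. Qed.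

Lemma in_plane_sum w n (c : 'I_n -> K) (F : 'I_n -> vect K) : reduced w ->
  (forall i, in_plane w (F i)) -> in_plane w (\sum_i c i *: F i).
Proof.
move=> rw; elim: n c F => [|n IH] c F hF; first by rewrite big_ord0; apply: in_plane0.
rewrite big_ord_recl; apply: in_plane_linear => //; exact: IH.
Qed.

End Plane.

(** * Degrees of the characteristic polynomials *)

Section BesselPoly.
Variables (K : numFieldType) (N : nat) (r : 'I_N -> K).

Lemma size_bessel_poly : size (bessel_poly r) = N.+1.
Proof. by rewrite size_prod_XsubC [index_enum _]unlock -enumT size_enum_ord. Qed.

Lemma wchar_poly_monic n : wchar_poly r n \is monic.
Proof.
apply: monic_prod => j _; rewrite monicE lead_coef_comp ?size_XsubC //.
by rewrite lead_coefXsubC expr1n mulr1; apply/eqP/monicP/monic_prod_XsubC.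
Qed.

Lemma size_wchar_poly n : size (wchar_poly r n) = (n * N).+1.
Proof.
elim: n => [|n IH]; first by rewrite /wchar_poly big_ord0 size_poly1.
have hc : size (bessel_poly r \Po ('X - (n%:R)%:P)) = N.+1.
  by rewrite size_comp_poly2 ?size_XsubC // size_bessel_poly.
rewrite /wchar_poly big_ord_recr /= -/(wchar_poly r n) size_monicM ?wchar_poly_monic //.
  by rewrite IH hc; lia.
by rewrite -size_poly_gt0 hc.
Qed.

End BesselPoly.

(** * The plane of a wave function and its stabilizer *)

Section Bessel.
Variables (K : numFieldType) (N : nat) (s : K) (r : 'I_N -> K) (Psi : vect K).
Hypothesis N_gt0 : (0 < N)%N.
Hypothesis wave : is_bessel_wave r s Psi.
Implicit Types (p q : {poly K}) (k l : int).
Local Notation D := (Dact N s).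
Local Notation Z := (@zact K N).
Local Notation pD := (pD N s).
Local Notation diffop := (diffop N s).

(** The new factor [P(D - n)] becomes [P(D)] when moved past [z^n]. *)
Lemma wave_pow n : pD (wchar_poly r n) Psi = Z n%:Z Psi.
Proof.
have [_ _ hw] := wave; elim: n => [|n IH].
  by rewrite /wchar_poly big_ord0 -polyC1 pDC scale1r zact0.
have -> : wchar_poly r n.+1 = shiftp (- n%:Z) (bessel_poly r) * wchar_poly r n.
  rewrite /wchar_poly big_ord_recr /= mulrC; congr (_ * _).
  by rewrite /shiftp intrN polyCN.
rewrite pDM IH pD_zact // shiftpK -(zact0 N (pD (bessel_poly r) Psi)) -diffopE hw zactD.
by rewrite -PoszD addn1.
Qed.

(* The plane in reduced echelon form: D v_{-k} = v_{-k-1} + (s+k)/N v_{-k}, and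
   the component along v_0 comes from the component of the previous vector
   along v_1. *)
Fixpoint wred (k : nat) : vect K :=
  if k is k'.+1 then
    D (wred k') - ((s + k'%:R) / N%:R) *: wred k' - wred k' 1 *: Psi
  else Psi.

Lemma wred_reduced : reduced wred.
Proof.
have [w0 wneg _] := wave; elim=> [|k IH] c /=.
  by case: c => [|c]; [rewrite oppr0 w0 | rewrite wneg //; lia].
rewrite -[LHS]/(wred k (- c%:Z + 1) + (s - (- c%:Z)%:~R) / N%:R * wred k (- c%:Z)
  - (s + k%:R) / N%:R * wred k (- c%:Z) - wred k 1 * Psi (- c%:Z)).
rewrite IH; case: c => [|c].
  rewrite oppr0 add0r w0 /=; rewrite mulr0z; case: eqP => [->|_]; rewrite ?(mulr0, mulr1, addr0, subr0) ?addrK subrr //.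
have -> : - c.+1%:Z + 1 = - c%:Z by lia.
rewrite IH wneg ?oppr_lt0 // mulr0 subr0 -addrA eqSS.
have -> : (- c.+1%:Z)%:~R = - c.+1%:R :> K by rewrite intrN.
rewrite opprK; case: (k =P c.+1) => [->|_]; last by rewrite !mulr0 subrr addr0.
by rewrite subrr addr0.
Qed.

Lemma wred_pD (k : nat) : exists p, wred k = pD p Psi.
Proof.
elim: k => [|k [p IH]] /=; first by exists 1; rewrite -polyC1 pDC scale1r.
exists (p * 'X + (- ((s + k%:R) / N%:R)) *: p + (- wred k 1)%:P).
rewrite !pD_addp pD_mulX pD_Dact pDC pD_scale !scaleNr.
by rewrite -IH.
Qed.

(** It suffices that [D] preserves the plane, and the definition of [wred k.+1], read backwards,
    expresses [D (wred k)] in the frame. *)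
Lemma in_plane_pD p : in_plane wred (pD p Psi).
Proof.
have rw := wred_reduced.
have DD (k : nat) : in_plane wred (D (wred k)).
  have -> : D (wred k) = 1 *: wred k.+1 + ((s + k%:R) / N%:R *: wred k + wred k 1 *: Psi).
    by rewrite scale1r /= addrA [X in _ = X + _]addrAC !subrK.
  apply: in_plane_linear => //; first exact: in_plane_frame.
  apply: in_plane_linear => //; first exact: in_plane_frame.
  have -> : wred k 1 *: Psi = wred k 1 *: wred 0 + 0 by rewrite addr0.
  by apply: in_plane_linear => //; [exact: in_plane_frame | exact: in_plane0].
have Dcl f : in_plane wred f -> in_plane wred (D f).
  move=> [n h]; have -> : f = \sum_(c < n) f (- c%:Z) *: wred c.
    by apply/funext => x; rewrite {1}h fct_sumE.
  have DDn g1 g2 : D (g1 + g2) = D g1 + D g2.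
    by have := Dact_linear N s 1 g1 g2; rewrite !scale1r.
  rewrite (big_morph _ DDn (Dact0 N s)).
  under eq_bigr => c _.
    have := Dact_linear N s (f (- c%:Z)) (wred c) 0; rewrite Dact0 !addr0 => ->.
    over.
  exact: in_plane_sum.
apply: in_plane_sum => // i; elim: (nat_of_ord i) => [|n IH] /=; last exact: Dcl.
exact: (in_plane_frame 0 rw).
Qed.

(** Since [w b] vanishes below [-b], its expansion involves only [wred c] with [c <= b]; the change
    of basis is triangular. *)
Lemma wedge_admissible w : admissible_basis (bessel_plane N s Psi) w -> wedge w = wedge wred.
Proof.
move=> [fw hw]; have rw := wred_reduced.
apply: (@wedge_triangular _ _ _ (fun c b => w b (- c%:Z)) (reduced_frame rw)) => //.
move=> b; apply: in_plane_widen => //; last by move=> c hc; apply: (fw b).2; lia.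
have : bessel_plane N s Psi (w b).
  rewrite -hw; exists 1%N, (fun _ => 1), (fun _ => w b).
  by split=> [_|]; [exists b | rewrite big_ord1 scale1r].
case=> n [c [x [hx ->]]]; apply: in_plane_sum => // i.
by have [l _ <-] := hx i; rewrite -pD_Xn; apply: in_plane_pD.
Qed.

Definition stabilizes k p := forall q, exists q', diffop k p (pD q Psi) = pD q' Psi.

Lemma stabilizes_nat (n : nat) p : stabilizes n%:Z p.
Proof.
move=> q; exists (shiftp (- n%:Z) (p * q) * wchar_poly r n).
rewrite diffopE -pDM [RHS]pDM wave_pow pD_zact //; congr (Z _ (pD _ _)).
by rewrite shiftpK.
Qed.

Lemma stabilizes_wchar (n : nat) p : stabilizes (- n%:Z) (wchar_poly r n * p).
Proof.
move=> q; exists (shiftp n%:Z (p * q)).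
rewrite diffopE -pDM -mulrA mulrC pDM wave_pow pD_zact // zactD addNr zact0.
by [].
Qed.

Definition eigen k p : K := \sum_(i < width N k p)
  (diffop k p (wred i) (- i%:Z) - diffop_mx N s k p (- i%:Z) (- i%:Z)).

Lemma rhat_op_stable k p : stabilizes k p ->
  rhat_op N s k p (wedge wred) = eigen k p *: wedge wred.
Proof.
move=> st; apply: rhat_wedge.
- exact: diffop_banded.
- exact: diffop_op_matrix.
- exact: wred_reduced.
by move=> b; have [q ->] := wred_pD b; have [q' ->] := st q; apply: in_plane_pD.
Qed.

Lemma W_fock_stable k p : stabilizes k p ->
  W_fock N s k p (wedge wred) = (eigen k p + gamma N s k p) *: wedge wred.
Proof. by move=> st; rewrite /W_fock rhat_op_stable // scalerDl. Qed.

Lemma W_fock_scale k p (c : K) v : W_fock N s k p (c *: v) = c *: W_fock N s k p v.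
Proof.
have e0 : W_fock N s k p 0 = 0.
  by have := W_fock_linear N s k p (-1) 0 0; rewrite scaler0 addr0 scaleN1r addNr.
by have := W_fock_linear N s k p c v 0; rewrite e0 !addr0.
Qed.

Lemma W_fock_stable0 k p : k != 0 -> stabilizes k p ->
  W_fock N s k p (wedge wred) = 0.
Proof.
move=> k0 st; have := W_fock_D s N_gt0 p (wedge wred) k0.
rewrite (W_fock_stable st) (W_fock_stable (@stabilizes_nat 0 'X)) !W_fock_scale.
rewrite (W_fock_stable st) (W_fock_stable (@stabilizes_nat 0 'X)) !scalerA.
rewrite [(_ + _) * (eigen k p + _)]mulrC subrr -scalerA => /esym/eqP.
by rewrite scaler_eq0 intr_eq0 (negPf k0) => /eqP.
Qed.

Lemma wedge_wred_vac : wedge wred smon_vac = 1.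
Proof. by rewrite /wedge /wedge_minor det_mx00. Qed.

Lemma wchar_poly_min (n : nat) (b : {poly K}) : (0 < n)%N -> b != 0 ->
  W_fock N s (- n%:Z) b (wedge wred) = 0 -> (size (wchar_poly r n) <= size b)%N.
Proof.
move=> n0 b0; have fw := reduced_frame wred_reduced.
rewrite size_wchar_poly; case: (leqP (n * N).+1 (size b)) => // hb W0; exfalso.
have bs : (0 < size b)%N by rewrite size_poly_gt0.
(* [e] is the least rise of an index under [z^(-n) b(D)], attained with coefficient [lead_coef b];
   [m1] below is the vacuum with [v_0] replaced by [v_e]. *)
pose e := (n * N - (size b).-1)%N; have e0 : (0 < e)%N by rewrite /e; lia.
pose A := diffop_mx N s (- n%:Z) b.
have hA i j : A i j != 0 -> j <= i - e%:Z.
  by move=> /diffop_mx_supp /andP[_]; rewrite mulNr -PoszM /e; lia.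
have lead : A e%:Z 0 = lead_coef b.
  rewrite -(diffop_mx_lead N s (- n%:Z) b 0); congr (A _ _).
  by rewrite mulNr -PoszM /e; lia.
pose L := width N (- n%:Z) b.
have bA : banded L A by apply: diffop_banded.
have tr0 i : sea_tr i A = 0.
  by rewrite /sea_tr big1 // => c _; apply/eqP; apply: contraT => /hA; lia.
pose tau := wedge wred; have t1 : tau smon_vac = 1 := wedge_wred_vac.
(* The part of the derivation acting below the first factor only moves factors
   onto filled positions. *)
have low i (m : smon) (a : 'I_i) x : (size m <= i)%N -> smon_ix m a <= 1 - (size m)%:Z ->
    A (smon_ix m a) (win i x) * ext tau (upd (fun a : 'I_i => smon_ix m a) a (win i x)) = 0.
  move=> hm ha; have [->|/hA hx] := eqVneq (A (smon_ix m a) (win i x)) 0.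
    by rewrite mul0r.
  rewrite ext_upd_low ?win_gt //; last by lia.
  by case: eqP => [ex|]; [lia | rewrite mul0r mulr0].
have rv : rhat_op N s (- n%:Z) b tau smon_vac = 0.
  have hM : smon_ix smon_vac 0 + L%:Z <= L%:Z by rewrite smon_ix_tail // oppr0 add0r.
  rewrite /rhat_op (@rhat_band _ L L L _ tau smon_vac bA (leqnn L) hM).
  rewrite tr0 mul0r subr0 /opn big1 // => a _; rewrite big1 // => x _.
  apply: low => //; rewrite smon_ix_tail //=; lia.
have pe : is_partition [:: e] by rewrite /is_partition /= inE; lia.
pose m1 := Smon pe.
have re : rhat_op N s (- n%:Z) b tau m1 = lead_coef b.
  have hM : smon_ix m1 0 + L%:Z <= (e + L)%N%:Z by rewrite /smon_ix /= subr0 PoszD.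
  rewrite /rhat_op (@rhat_band _ L L.+1 (e + L) _ tau m1 bA (leqnn L.+1) hM).
  rewrite tr0 mul0r subr0 /opn big_ord_recl [X in _ + X]big1 ?addr0 => [|a _]; last first.
    by rewrite big1 // => x _; apply: low => //; rewrite smon_ix_tail //=; lia.
  have h0 : 0 <= (e + L)%N%:Z by [].
  have [x0 ex0] : exists x : 'I_(L.+1 + (e + L)), 0 = win L.+1 x by apply: winP; lia.
  rewrite (bigD1 x0) //= -ex0 big1 ?addr0 => [|x hx].
    rewrite -[smon_ix m1 0]/(e%:Z - 0) subr0 lead (_ : ext _ _ = 1) ?mulr1 //.
    rewrite -t1 -(@ext_smon _ L.+1 tau smon_vac) //; apply: eq_ext => a; rewrite /upd.
    case: eqP => [->|ne]; first by rewrite /smon_ix.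
    rewrite !smon_ix_tail //=; case: a ne => [[|a] ha] // ne.
    by case: ne; apply: val_inj.
  have [->|/hA hx'] := eqVneq (A (smon_ix m1 0) (win L.+1 x)) 0; first by rewrite mul0r.
  have nx : win L.+1 x != 0.
    rewrite ex0; apply: contra hx => /eqP hw; apply/eqP; apply: val_inj => /=.
    by move: hw; rewrite /win; lia.
  have s0 : smon_ix m1 0 = e%:Z by rewrite /smon_ix /= subr0.
  rewrite (@ext_upd_low _ L.+1 tau m1 ord0) ?win_gt //; last by rewrite /=; lia.
  by rewrite [smon_ix m1 _]s0; case: eqP => [ex|]; [lia | rewrite mul0r mulr0].
rewrite /W_fock in W0.
(* The vacuum component forces [gamma] to vanish; the component at [m1] then gives
   [lead_coef b = 0]. *)
have := congr1 (fun f => f smon_vac) W0.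
rewrite -[X in X = _ -> _]/(rhat_op N s (- n%:Z) b tau smon_vac
   + gamma N s (- n%:Z) b * tau smon_vac) rv t1 mulr1 add0r => g0.
move: W0; rewrite g0 scale0r addr0 => /(congr1 (fun f => f m1)).
by rewrite re => /eqP; rewrite -[_ m1]/(0 : K) lead_coef_eq0 (negPf b0).
Qed.

End Bessel.

(** * Quasifiniteness *)

Section Spans.
Variables (K : numFieldType) (V : lmodType K).
Implicit Types (S T : set V) (u v : V).

Lemma lspan0 S : lspan S 0.
Proof. by exists 0%N, (fun _ => 0), (fun _ => 0); split=> [[]//|]; rewrite big_ord0. Qed.

Lemma lspan_mem S u : S u -> lspan S u.
Proof. by exists 1%N, (fun _ => 1), (fun _ => u); split=> //; rewrite big_ord1 scale1r. Qed.

Lemma lspan_linear S (a : K) u v : lspan S u -> lspan S v -> lspan S (a *: u + v).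
Proof.
move=> [n [c [x [hx ->]]]] [m [d [y [hy ->]]]].
exists (n + m)%N, (fun i => match fintype.split i with inl j => a * c j | inr j => d j end),
  (fun i => match fintype.split i with inl j => x j | inr j => y j end); split=> [i|].
  by case: fintype.split => j.
rewrite big_split_ord /= scaler_sumr; congr (_ + _); apply: eq_bigr => i _.
  by rewrite -[lshift m i]/(unsplit (inl i)) unsplitK scalerA.
by rewrite -[rshift n i]/(unsplit (inr i)) unsplitK.
Qed.

Lemma lspan_scale S (a : K) u : lspan S u -> lspan S (a *: u).
Proof. by move=> h; rewrite -[_ *: _]addr0; apply: lspan_linear => //; apply: lspan0. Qed.

Lemma lspan_add S u v : lspan S u -> lspan S v -> lspan S (u + v).
Proof. by move=> h1 h2; rewrite -[u]scale1r; apply: lspan_linear. Qed.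

Lemma lspan_sum S n (c : 'I_n -> K) (x : 'I_n -> V) :
  (forall i, lspan S (x i)) -> lspan S (\sum_(i < n) c i *: x i).
Proof.
move=> h; elim/big_ind: _ => [|u v|i _]; first exact: lspan0.
  exact: lspan_add.
exact: lspan_scale.
Qed.

Lemma lspan_sub S T u : (forall x, S x -> lspan T x) -> lspan S u -> lspan T u.
Proof. by move=> h [n [c [x [hx ->]]]]; apply: lspan_sum => i; apply/h/hx. Qed.

Lemma lspan_map S T (F : V -> V) u :
  (forall (a : K) x y, F (a *: x + y) = a *: F x + F y) ->
  (forall x, S x -> lspan T (F x)) -> lspan S u -> lspan T (F u).
Proof.
move=> lF h [n [c [x [hx ->]]]].
have F0 : F 0 = 0.
  by have := lF (-1) 0 0; rewrite scaler0 addr0 scaleN1r addNr.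
have FD a b : F (a + b) = F a + F b by have := lF 1 a b; rewrite !scale1r.
rewrite (big_morph F FD F0); under eq_bigr => i _.
  have := lF (c i) (x i) 0; rewrite F0 !addr0 => ->.
  over.
by apply: lspan_sum => i; apply/h/hx.
Qed.

Lemma lspan_seq_findim (s : seq V) : findim (lspan [set x | x \in s]).
Proof.
exists (size s), (fun i => nth 0 s i); congr lspan; apply/seteqP; split=> x /=.
  by move=> /(nthP 0) [i hi <-]; exists (Ordinal hi).
by move=> [i _ <-]; apply: mem_nth.
Qed.

End Spans.

(** * The graded module of a highest weight vector *)

Section HighestWeight.
Variables (K : numFieldType) (N : nat) (s : K).
Variables (sigma : fock K -> tseries K) (sigma' : tseries K -> fock K).
Hypothesis N_gt0 : (0 < N)%N.
Hypothesis sigma_linear : linear sigma.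
Hypothesis sigmaK : cancel sigma sigma'.
Hypothesis sigma'K : cancel sigma' sigma.
Local Notation V := (tseries K).
Local Notation W := (W N s sigma sigma').
Implicit Types (p q : {poly K}) (k l : int) (u v : V).

Lemma sigma'_linear (a : K) u v : sigma' (a *: u + v) = a *: sigma' u + sigma' v.
Proof. by rewrite -{1}(sigma'K u) -{1}(sigma'K v) -sigma_linear sigmaK. Qed.

Lemma W_linear k p (a : K) u v : W k p (a *: u + v) = a *: W k p u + W k p v.
Proof. by rewrite /W sigma'_linear W_fock_linear sigma_linear. Qed.

Lemma W_linear_p k p q (a : K) v : W k (a *: p + q) v = a *: W k p v + W k q v.
Proof. by rewrite /W W_fock_linear_p sigma_linear. Qed.

Lemma sigmaB x y : sigma (x - y) = sigma x - sigma y.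
Proof. by rewrite addrC -scaleN1r sigma_linear scaleN1r addrC. Qed.

Lemma sigmaZ (a : K) x : sigma (a *: x) = a *: sigma x.
Proof.
have s0 : sigma 0 = 0.
  by have := sigma_linear (-1) 0 0; rewrite scaler0 addr0 scaleN1r addNr.
by have := sigma_linear a x 0; rewrite s0 !addr0.
Qed.

Lemma W_comm k l p q : exists c : K, forall v,
  W k p (W l q v) - W l q (W k p v) = W (k + l) (bracket k l p q) v + c *: v.
Proof.
have [c hc] := W_fock_comm s N_gt0 k l p q; exists c => v.
rewrite /W !sigmaK -sigmaB hc -[X in sigma (X + _)]scale1r sigma_linear scale1r.
by rewrite sigmaZ sigma'K.
Qed.

Lemma W_D k p v : k != 0 -> W 0 'X (W k p v) - W k p (W 0 'X v) = k%:~R *: W k p v.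
Proof. by move=> k0; rewrite /W !sigmaK -sigmaB W_fock_D // sigmaZ. Qed.

Lemma W_scale k p (a : K) v : W k p (a *: v) = a *: W k p v.
Proof.
have e0 : W k p 0 = 0.
  by have := W_linear k p (-1) 0 0; rewrite scaler0 addr0 scaleN1r addNr.
by have := W_linear k p a v 0; rewrite e0 !addr0.
Qed.

Lemma W_add k p u v : W k p (u + v) = W k p u + W k p v.
Proof. by have := W_linear k p 1 u v; rewrite !scale1r. Qed.

Lemma W_sub k p u v : W k p (u - v) = W k p u - W k p v.
Proof. by rewrite W_add -scaleN1r W_scale scaleN1r. Qed.

(* Comparing the brackets with W(D) on both sides kills the central term. *)
Lemma W_comm_neg k l p q v : k < 0 -> l < 0 ->
  W k p (W l q v) - W l q (W k p v) = W (k + l) (bracket k l p q) v.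
Proof.
move=> hk hl; have [c hc] := W_comm k l p q; rewrite hc.
have k0 : k != 0 by rewrite lt_eqF.
have l0 : l != 0 by rewrite lt_eqF.
have kl0 : k + l != 0 by lia.
have Dk k' p' w : k' != 0 -> W 0 'X (W k' p' w) = W k' p' (W 0 'X w) + k'%:~R *: W k' p' w.
  by move=> h; rewrite -(W_D _ _ h) addrC subrK.
have mod_id (a b x y : V) : a + l%:~R *: x + k%:~R *: x - (b + k%:~R *: y + l%:~R *: y)
    = a - b + (k + l)%:~R *: (x - y).
  apply/funext => e.
  rewrite -[LHS]/(a e + l%:~R * x e + k%:~R * x e - (b e + k%:~R * y e + l%:~R * y e)).
  by rewrite -[RHS]/(a e - b e + (k + l)%:~R * (x e - y e)) intrD; ring.
have h1 : W 0 'X (W k p (W l q v) - W l q (W k p v)) =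
    W k p (W l q (W 0 'X v)) - W l q (W k p (W 0 'X v))
    + (k + l)%:~R *: (W k p (W l q v) - W l q (W k p v)).
  by rewrite W_sub !Dk // !W_add !W_scale mod_id.
rewrite (hc v) (hc (W 0 'X v)) in h1; move: h1.
set x := W (k + l) _ v; set y := W 0 'X v; set z := W (k + l) _ y => h1.
have gen (a b d w : V) : a + b + (d + w) = a + d + b -> w = 0.
  by move=> e; apply: (addrI (a + d + b)); rewrite addr0 -[RHS]e addrACA addrA.
have h2 : W 0 'X (x + c *: v) = z + (k + l)%:~R *: x + c *: y.
  by rewrite W_add W_scale (Dk _ _ _ kl0).
rewrite h2 scalerDr in h1; have /eqP := gen _ _ _ _ (esym h1).
by rewrite scaler_eq0 intr_eq0 (negPf kl0) => /eqP ->; rewrite addr0.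
Qed.

Variables (tau : V) (P : nat -> {poly K}).
Hypothesis tau_nonneg : forall k p, 0 <= k -> exists c : K, W k p tau = c *: tau.
Hypothesis P_neq0 : forall n, P n != 0.
Hypothesis tau_ann : forall n p, (0 < n)%N -> W (- n%:Z) (P n * p) tau = 0.
Local Notation word := (W_word N s sigma sigma').
Local Notation level := (level N s sigma sigma' tau).

Definition positive_word (x : seq (nat * {poly K})) := all (fun kf => 0 < kf.1)%N x.

Definition words d : set V := [set u | exists x,
  [/\ positive_word x, sumn (map fst x) = d & u = word x tau]].

Lemma words_cons d n p u : (0 < n)%N -> words d u -> words (n + d) (W (- n%:Z) p u).
Proof.
by move=> hn [x [h1 h2 ->]]; exists ((n, p) :: x); split; rewrite /= ?hn // h2.
Qed.

(** In each negative degree a nonzero ideal of polynomials kills [u]. Division with remainder then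
    bounds the orbit of [u] in that degree. *)
Definition annihilable u := forall n, (0 < n)%N ->
  exists2 b, b != 0 & forall p, W (- n%:Z) (b * p) u = 0.

Lemma shiftp_neq0 k p : p != 0 -> shiftp k p != 0.
Proof. by rewrite -!size_poly_gt0 /shiftp size_comp_poly2 // size_XaddC. Qed.

(** As [b1] kills [u] in degree [-n], the operator acts on the longer word as a bracket of degree
    [-(n + j)] applied to [u], which vanishes once [b2] divides both terms of the bracket. *)
Lemma annihilable_word x : positive_word x -> annihilable (word x tau).
Proof.
elim: x => [_|[j h] x IH /= /andP[hj hx]] n hn.
  by exists (P n) => // p; apply: tau_ann.
set u := W_word _ _ _ _ _ _; have au : annihilable u := IH hx.
have [b1 b1n hb1] := au n hn; have [|b2 b2n hb2] := au (n + j)%N; first by rewrite addn_gt0 hn.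
(* Moving b past z^(-j) shifts it, which turns the last factor into b2. *)
exists (b1 * b2 * shiftp j%:Z b2) => [|p].
  by rewrite !mulf_neq0 ?shiftp_neq0.
have := @W_comm_neg (- n%:Z) (- j%:Z) (b1 * b2 * shiftp j%:Z b2 * p) h u.
rewrite !oppr_lt0 => /(_ hn hj).
have -> : W (- n%:Z) (b1 * b2 * shiftp j%:Z b2 * p) u = 0 by rewrite -!mulrA hb1.
have -> : W (- j%:Z) h 0 = 0 by have := W_scale (- j%:Z) h 0 0; rewrite !scale0r.
rewrite subr0 => ->.
have shM k a b : shiftp k (a * b) = shiftp k a * shiftp k b by apply: comp_polyM.
have -> : bracket (- n%:Z) (- j%:Z) (b1 * b2 * shiftp j%:Z b2 * p) h
  = b2 * (shiftp (- j%:Z) (b1 * b2) * shiftp (- j%:Z) p * h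
          - shiftp (- n%:Z) h * b1 * shiftp j%:Z b2 * p).
  rewrite /bracket !shM; have := shiftpK (- j%:Z) b2; rewrite opprK => ->; ring.
by rewrite -opprD -PoszD hb2.
Qed.

(** The spanning vectors are themselves words, so [annihilable_word] applies to each of them in the
    induction on [d]. *)
Definition finite_words d (U : set V) := exists2 t : seq V,
  (forall x, x \in t -> words d x) & forall u, U u -> lspan [set x | x \in t] u.

Lemma finite_words_union (T : eqType) d (l : seq T) (U : T -> set V) :
  (forall i, i \in l -> finite_words d (U i)) ->
  finite_words d [set u | exists2 i, i \in l & U i u].
Proof.
elim: l => [|i l IH] h; first by exists [::] => // u [].
have [t1 h1 h2] := h i (mem_head i l).
have [|t2 h3 h4] := IH; first by move=> j hj; apply: h; rewrite in_cons hj orbT.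
exists (t1 ++ t2) => [x|u [j]].
  by rewrite mem_cat => /orP[/h1|/h3].
rewrite in_cons => /orP[/eqP -> /h2|hj hu].
  by apply: lspan_sub => x hx; apply: lspan_mem; rewrite /= mem_cat hx.
by apply: lspan_sub (h4 u (ex_intro2 _ _ j hj hu)) => x hx; apply: lspan_mem; rewrite /= mem_cat hx orbT.
Qed.

Lemma W_sum_p k n (c : 'I_n -> K) (F : 'I_n -> {poly K}) v :
  W k (\sum_i c i *: F i) v = \sum_i c i *: W k (F i) v.
Proof.
have e0 : W k 0 v = 0.
  by have := W_linear_p k 0 0 (-1) v; rewrite scaler0 addr0 scaleN1r addNr.
have eD p q : W k (p + q) v = W k p v + W k q v.
  by have := W_linear_p k p q 1 v; rewrite !scale1r.
rewrite (big_morph (fun p => W k p v) eD e0); apply: eq_bigr => i _.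
by have := W_linear_p k (F i) 0 (c i) v; rewrite e0 !addr0.
Qed.

Lemma finite_words_orbit d n x : (0 < n)%N -> words d x ->
  finite_words (n + d) [set u | exists p, u = W (- n%:Z) p x].
Proof.
move=> hn wx; have : annihilable x by case: wx => y [hy _ ->]; apply: annihilable_word.
move=> /(_ n hn) [b bn hb].
exists [seq W (- n%:Z) 'X^i x | i <- iota 0 (size b)] => [y /mapP[i _ ->]|u [p ->]].
  exact: words_cons.
rewrite (divp_eq p b) mulrC -[b * _]scale1r W_linear_p hb scaler0 add0r.
have hs : (size (p %% b)%R <= size b)%N by rewrite ltnW // ltn_modp.
have -> : p %% b = \sum_(i < size b) (p %% b)`_i *: 'X^i.
  by rewrite -poly_def; apply/polyP => i; rewrite coef_poly; case: ltnP => // hi;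
     rewrite nth_default // (leq_trans hs).
rewrite W_sum_p; apply: lspan_sum => i; apply: lspan_mem => /=.
by apply/mapP; exists (nat_of_ord i) => //; rewrite mem_iota /=.
Qed.

(** Strong induction on [d], splitting by the degree [n] of the leftmost letter: that letter acts on
    a finite spanning set of words of degree [d - n]. *)
Lemma words_finite d : finite_words d (words d).
Proof.
elim: {d}_.+1 {-2}d (ltnSn d) => // d0 IH d hd.
have [d_eq0|d_gt0] := posnP d.
  exists [:: tau] => [x|u [[|[n p] x] [/= h1 h2 ->]]].
  - by rewrite inE => /eqP ->; exists [::]; rewrite d_eq0.
  - by apply: lspan_mem; rewrite /= inE.
  by move: h1 h2 => /andP[hn _]; rewrite d_eq0; lia.
pose U n : set V := [set u | exists p y, [/\ (0 < n)%N, words (d - n) y & u = W (- n%:Z) p y]].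
have [|t h1 h2] := @finite_words_union _ d (iota 1 d) U; last first.
  exists t => // u [[|[n p] x] [/= hp hs ->]]; first by move: d_gt0; rewrite -hs.
  move/andP: hp => [hn hx]; apply: h2; exists n.
    by rewrite mem_iota -hs; lia.
  exists p, (word x tau); split=> //; exists x; split=> //.
  by rewrite -hs addKn.
move=> n; rewrite mem_iota add1n ltnS => /andP[hn hnd].
have [|t ht1 ht2] := IH (d - n)%N; first by lia.
have [|t' h1 h2] := @finite_words_union _ d t (fun x => [set u | exists p, u = W (- n%:Z) p x]).
  move=> x hx; have := finite_words_orbit hn (ht1 x hx).
  by rewrite subnKC.
exists t' => // u [p [y [_ /ht2 hy ->]]].
apply: (lspan_map (W_linear (- n%:Z) p) _ hy) => x hx; apply: h2.
by exists x => //; exists p.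
Qed.

Lemma levelE d : level d = lspan (words d). Proof. by []. Qed.

Lemma level_findim d : findim (level d).
Proof.
have [t h1 h2] := words_finite d.
suff -> : level d = lspan [set x | x \in t] by apply: lspan_seq_findim.
apply/seteqP; split=> u; rewrite levelE; apply: lspan_sub => // x hx.
by apply: lspan_mem; apply: h1.
Qed.

Lemma level_eigen (mu : K) d u : W 0 'X tau = mu *: tau -> level d u ->
  W 0 'X u = (mu - d%:R) *: u.
Proof.
move=> hmu [n [c [x [hx ->]]]].
have W0 : W 0 'X 0 = 0 by have := W_scale 0 'X 0 0; rewrite !scale0r.
rewrite (big_morph (W 0 'X) (W_add 0 'X) W0) scaler_sumr; apply: eq_bigr => i _.
rewrite W_scale !scalerA mulrC -scalerA; congr (_ *: _).
have [y [hy <- ->]] := hx i; elim: y hy => [|[j p] y IH] /= => [_|/andP[hj hy]].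
  by rewrite subr0.
have jn : - j%:Z != 0 by rewrite oppr_eq0; lia.
have := W_D p (word y tau) jn; rewrite (IH hy) W_scale => /eqP.
rewrite subr_eq => /eqP ->; rewrite -scalerDl natrD intrN; congr (_ *: _).
by rewrite opprD addrCA.
Qed.

(** The levels are eigenspaces of [W(D)] with distinct eigenvalues [mu - d]; subtracting the top
    eigenvalue removes the last summand and multiplies the others by [n - d]. *)
Lemma levels_direct n (x : 'I_n -> V) : (forall d : 'I_n, level d (x d)) ->
  \sum_(d < n) x d = 0 -> forall d, x d = 0.
Proof.
have [mu hmu] := tau_nonneg 'X (lexx 0).
elim: n x => [|n IH] x hx hs; first by case.
have W0 : W 0 'X 0 = 0 by have := W_scale 0 'X 0 0; rewrite !scale0r.
have h1 : \sum_(d < n) (n - d)%:R *: x (widen_ord (leqnSn n) d) = 0.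
  have := congr1 (W 0 'X) hs; rewrite (big_morph (W 0 'X) (W_add 0 'X) W0) W0.
  under eq_bigr do rewrite (level_eigen hmu (hx _)).
  move=> h; have : \sum_(d < n.+1) ((mu - d%:R) *: x d - (mu - n%:R) *: x d) = 0.
    by rewrite sumrB h -scaler_sumr hs scaler0 subr0.
  rewrite big_ord_recr /= subrr addr0 => h0; rewrite -[RHS]h0; apply: eq_bigr => d _.
  by rewrite -scalerBl natrB 1?ltnW //; congr (_ *: _); ring.
have h2 (d : 'I_n) : x (widen_ord (leqnSn n) d) = 0.
  have := IH (fun d => (n - d)%:R *: x (widen_ord (leqnSn n) d)) _ h1 d.
  have hl (d' : 'I_n) : level d' ((n - d')%:R *: x (widen_ord (leqnSn n) d')).
    by apply: lspan_scale; apply: (hx (widen_ord (leqnSn n) d')).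
  move=> /(_ hl)/eqP; rewrite scaler_eq0 pnatr_eq0 subn_eq0 leqNgt ltn_ord /=.
  by move/eqP.
move=> d; case: (unliftP ord_max d) => [d'|] ->.
  by rewrite -[RHS](h2 d'); congr x; apply: val_inj; rewrite /= /bump leqNgt ltn_ord.
by move: hs; rewrite big_ord_recr /= big1 ?add0r.
Qed.

Definition all_words : set V := [set u | exists d, words d u].

(** An operator of nonnegative degree is commuted to the right until it meets [tau]. The commutators
    may have either sign of degree, but they act on a shorter word. *)
Lemma W_all_words x k p : positive_word x -> lspan all_words (W k p (word x tau)).
Proof.
have neg y l q : l < 0 -> positive_word y -> lspan all_words (W l q (word y tau)).
  move=> hl hy; apply: lspan_mem; have -> : l = - (absz l)%:Z by lia.
  exists (absz l + sumn (map fst y))%N; apply: words_cons; first by lia.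
  by exists y.
elim: x k p => [|[j f] x IH] k p hx; have [hk|hk] := ltP k 0; try exact: neg.
  have [c ->] := tau_nonneg p hk; apply: lspan_scale; apply: lspan_mem.
  by exists 0%N, [::].
move: hx => /= /andP[hj hx]; have [c hc] := W_comm k (- j%:Z) p f.
rewrite -[W k p _](subrK (W (- j%:Z) f (W k p (word x tau)))) hc.
apply: lspan_add; first apply: lspan_add.
- exact: IH.
- by apply: lspan_scale; apply: lspan_mem; exists (sumn (map fst x)), x.
apply: (lspan_map (W_linear _ _) _ (IH k p hx)) => u [d hu].
by apply: lspan_mem; exists (j + d)%N; apply: words_cons.
Qed.

Lemma generated_levels : W_generated N s sigma sigma' tau = lspan (\bigcup_d level d).
Proof.
have aw : lspan (\bigcup_d level d) = lspan all_words.
  apply/seteqP; split=> u; apply: lspan_sub => x.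
    by case=> d _; apply: lspan_sub => y hy; apply: lspan_mem; exists d.
  by case=> d hd; apply: lspan_mem; exists d => //; apply: lspan_mem.
rewrite aw; apply/seteqP; split.
  move=> u; apply; split=> [|v /= ->]; last first.
    by apply: lspan_mem; exists 0%N, [::].
  split.
  - exact: lspan0.
  - by move=> a x y; apply: lspan_linear.
  - move=> k p x hx; apply: (lspan_map (W_linear k p) _ hx) => y [d [z [hz _ ->]]].
    exact: W_all_words.
  - by move=> x; apply: lspan_scale.
move=> u hu M [[M0 ML MW _] Mtau]; case: hu => n [c [x [hx ->]]].
elim/big_ind: _ => [//|a b ha hb|i _].
  by rewrite -[a]scale1r; apply: ML.
rewrite -[_ *: _]addr0; apply: ML => //; have [d [y [_ _ ->]]] := hx i.
by elim: y => [|[j p] y IHy] /=; [exact: Mtau | apply: MW].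
Qed.

Lemma quasifinite_tau : quasifinite N s sigma sigma' tau.
Proof.
split; last exact: level_findim.
split; [exact: generated_levels | exact: levels_direct].
Qed.

End HighestWeight.

(** * Highest weights *)

Section LeadingCoefficients.
Variables (K : numFieldType) (N : nat) (s : K).
Hypothesis N_gt0 : (0 < N)%N.
Implicit Types (f : vect K) (rs : seq K) (y : int).
Local Notation pD := (pD N s).
Local Notation pol := (fun rs => \prod_(x <- rs) ('X - x%:P)).

Lemma pD_factor (x : K) p f i :
  pD (('X - x%:P) * p) f i = pD p f (i + 1) + ((s - i%:~R) / N%:R - x) * pD p f i.
Proof.
rewrite pDM -polyCN pD_addp pDX pDC.
rewrite -[LHS]/(pD p f (i + 1) + (s - i%:~R) / N%:R * pD p f i + - x * pD p f i).
ring.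
Qed.

Lemma pD_prod_low f y rs : (forall i, i < y -> f i = 0) ->
  forall i, i < y - (size rs)%:Z -> pD (pol rs) f i = 0.
Proof.
move=> hf; elim: rs => [|x rs IH] i /= hi.
  by rewrite big_nil -polyC1 pDC scale1r hf //; lia.
by rewrite big_cons pD_factor !IH ?mulr0 ?addr0 //; lia.
Qed.

Lemma pD_prod_lead f y rs : (forall i, i < y -> f i = 0) ->
  pD (pol rs) f (y - (size rs)%:Z) = f y.
Proof.
move=> hf; elim: rs => [|x rs IH] /=.
  by rewrite big_nil -polyC1 pDC scale1r subr0.
rewrite big_cons pD_factor (_ : _ + 1 = y - (size rs)%:Z); last by lia.
by rewrite IH (@pD_prod_low _ y) ?mulr0 ?addr0 //; lia.
Qed.

(** Each factor adds [(s - i)/N - x], where the leading index [i] descends from [y]; this produces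
    the triangular number [n (n - 1)/2]. *)
Lemma pD_prod_second f y rs : (forall i, i < y -> f i = 0) ->
  let n : K := (size rs)%:R in
  pD (pol rs) f (y + 1 - (size rs)%:Z)
  = f (y + 1) + (n * (s - y%:~R) / N%:R + n * (n - 1) / (2%:R * N%:R) - \sum_(x <- rs) x) * f y.
Proof.
have Nn0 : N%:R != 0 :> K by rewrite pnatr_eq0 -lt0n.
move=> hf /=; elim: rs => [|x rs IH] /=.
  rewrite !big_nil -polyC1 pDC scale1r !subr0.
  by rewrite -[0%:R]/(0 : K); field.
rewrite !big_cons pD_factor (_ : _ + 1 = y + 1 - (size rs)%:Z); last by lia.
rewrite IH (_ : y + 1 - _ = y - (size rs)%:Z); last by lia.
rewrite pD_prod_lead // -[(size rs).+1]addn1 natrD intrB.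
by field.
Qed.

(* Adding a factor D - x changes the coefficients by c1 += y and
   c2 += (y - 1/N) c1, where y = (s + n)/N - x; the formula for c2 is the sum of
   these increments. *)
Lemma pD_prod_third f rs : (forall i, i < 0 -> f i = 0) ->
  let n : K := (size rs)%:R in
  let p1 := \sum_(x <- rs) x in
  let c1 := n * s / N%:R + n * (n - 1) / (2%:R * N%:R) - p1 in
  pD (pol rs) f (2%:Z - (size rs)%:Z)
  = f 2%:Z + (c1 - n / N%:R) * f 1
    + (c1 ^+ 2 / 2%:R - (\sum_(x <- rs) x ^+ 2) / 2%:R + (s + n - 1) / N%:R * p1
       - (n * s ^+ 2 + 2%:R * s * n * (n - 1) + n * (n - 1) * (4%:R * n - 5%:R) / 6%:R)
         / (2%:R * N%:R ^+ 2)) * f 0.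
Proof.
have Nn0 : N%:R != 0 :> K by rewrite pnatr_eq0 -lt0n.
move=> hf /=; elim: rs => [|x rs IH] /=.
  rewrite !big_nil -polyC1 pDC scale1r !subr0 -[0%:R]/(0 : K).
  by field.
rewrite !big_cons pD_factor (_ : _ + 1 = 2%:Z - (size rs)%:Z); last by lia.
rewrite IH (_ : 2%:Z - _ = 0 + 1 - (size rs)%:Z); last by lia.
rewrite (@pD_prod_second _ 0) // -[(size rs).+1]addn1 natrD !intrD intrN mulr0z.
by field.
Qed.

End LeadingCoefficients.

(** * Recursion and first coefficient of the wave function *)

Section WaveCoefficients.
Variables (K : numFieldType) (N : nat) (r : 'I_N -> K) (Psi : vect K).
Hypothesis N_gt0 : (0 < N)%N.
Local Notation s := (bessel_s r).
Hypothesis wave : is_bessel_wave r s Psi.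
Local Notation pD := (pD N s).
Local Notation roots := [seq r i | i <- index_enum 'I_N].

Lemma bessel_poly_seq : bessel_poly r = \prod_(x <- roots) ('X - x%:P).
Proof. by rewrite big_map. Qed.

Lemma size_roots : size roots = N.
Proof. by rewrite size_map [index_enum _]unlock -enumT size_enum_ord. Qed.

Lemma wave_eq x : pD (bessel_poly r) Psi x = Psi (x + N%:Z).
Proof. by have [_ _ hw] := wave; rewrite -[pD _ _](zact0 N) -diffopE hw /zact mul1r. Qed.

(** In the wave equation at index [y + 1 - N] the terms [Psi (y + 1)] cancel, and the value of [s]
    makes the coefficient of [Psi y] equal to [-y]. Only earlier coefficients remain on the
    right. *)
Lemma wave_recursion (y : int) :
  y%:~R * Psi y = pD (bessel_poly r) (fun i => if i < y then Psi i else 0) (y + 1 - N%:Z).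
Proof.
have Nn0 : N%:R != 0 :> K by rewrite pnatr_eq0 -lt0n.
set F := (fun i => if i < y then _ else _); pose G : vect K := fun i => if i < y then 0 else Psi i.
have eP : Psi = F + G.
  apply/funext => i; rewrite -[RHS]/(F i + G i) /F /G.
  by case: ifP; rewrite ?addr0 ?add0r.
have := wave_eq (y + 1 - N%:Z); rewrite subrK {1}eP pDD.
rewrite -[(_ + _ : vect K) _]/(pD _ F _ + pD _ G _).
have G0 i : i < y -> G i = 0 by rewrite /G => ->.
have := pD_prod_second s N_gt0 roots G0; rewrite /= -bessel_poly_seq size_roots => ->.
rewrite /G ltxx (_ : y + 1 < y = false); last by lia.
rewrite big_map; set p1 := \sum_(i <- _) r i.
have -> : s = p1 - (N%:R - 1) / 2%:R by [].
set a := pD _ F _; set b := Psi (y + 1); set c := Psi y => e.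
apply/eqP; rewrite -subr_eq0; apply/eqP.
transitivity (b - (a + (b + (N%:R * (p1 - (N%:R - 1) / 2%:R - y%:~R) / N%:R
  + N%:R * (N%:R - 1) / (2%:R * N%:R) - p1) * c))); first by field.
by rewrite e subrr.
Qed.

(** At index [2 - N] the terms [Psi 2] cancel, and the value of [s] makes [c1 = 0] in
    [pD_prod_third], so [Psi 1] enters with coefficient [-1]. *)
Lemma wave_first :
  Psi 1 = (s + N%:R - 1) / N%:R * (\sum_i r i) - (\sum_i r i ^+ 2) / 2%:R
    - (N%:R * s ^+ 2 + 2%:R * s * N%:R * (N%:R - 1)
       + N%:R * (N%:R - 1) * (4%:R * N%:R - 5%:R) / 6%:R) / (2%:R * N%:R ^+ 2).
Proof.
have Nn0 : N%:R != 0 :> K by rewrite pnatr_eq0 -lt0n.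
have [w0 wneg _] := wave.
have := wave_eq (2%:Z - N%:Z); rewrite subrK.
have := pD_prod_third s N_gt0 roots wneg; rewrite /= -bessel_poly_seq size_roots => ->.
rewrite !big_map w0 mulr1; set p1 := \sum_(i <- _) r i; set p2 := \sum_(i <- _) r i ^+ 2.
have -> : s = p1 - (N%:R - 1) / 2%:R by [].
set a := Psi 2%:Z; set b := Psi 1 => e.
apply/eqP; rewrite -subr_eq0; apply/eqP.
transitivity (a - (a + (N%:R * (p1 - (N%:R - 1) / 2%:R) / N%:R +
   N%:R * (N%:R - 1) / (2%:R * N%:R) - p1 - N%:R / N%:R) * b +
 ((N%:R * (p1 - (N%:R - 1) / 2%:R) / N%:R +
   N%:R * (N%:R - 1) / (2%:R * N%:R) - p1) ^+ 2 / 2%:R - p2 / 2%:R +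
  (p1 - (N%:R - 1) / 2%:R + N%:R - 1) / N%:R * p1 -
  (N%:R * (p1 - (N%:R - 1) / 2%:R) ^+ 2 +
   2%:R * (p1 - (N%:R - 1) / 2%:R) * N%:R * (N%:R - 1) +
   N%:R * (N%:R - 1) * (4%:R * N%:R - 5%:R) / 6%:R) / (2%:R * N%:R ^+ 2)))); first by field.
by rewrite e subrr.
Qed.

Lemma eigen_one : eigen N s Psi 0 1 = 0.
Proof.
have pD1 f : pD 1 f = f by rewrite -polyC1 pDC scale1r.
rewrite /eigen big1 // => i _; rewrite /diffop_mx !diffopE !zact0 !pD1.
by rewrite (wred_reduced N_gt0 wave) eqxx /vdelta eqxx subrr.
Qed.

(** The diagonal terms differ by the coordinate of [wred i] at [-i + 1]; for [i = 1] this is 0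
    because the frame is reduced. *)
Lemma eigen_X : eigen N s Psi 0 'X = Psi 1.
Proof.
have h i : diffop N s 0 'X (wred N s Psi i) (- i%:Z) - diffop_mx N s 0 'X (- i%:Z) (- i%:Z)
    = wred N s Psi i (- i%:Z + 1).
  rewrite /diffop_mx !diffopE !zact0 !pDX /Dact (wred_reduced N_gt0 wave) eqxx /vdelta eqxx.
  have -> : (- i%:Z + 1 == - i%:Z) = false by lia.
  by rewrite add0r addrK.
rewrite /eigen; have -> : width N 0 ('X : {poly K}) = 2%N by rewrite /width mul0n size_polyX.
rewrite (eq_bigr (fun i : 'I_2 => wred N s Psi i (- i%:Z + 1))) => [|i _]; last exact: h.
rewrite big_ord_recr big_ord_recl big_ord0 -[LHS]/(wred N s Psi 0 1 + 0 + wred N s Psi 1 (- 0%:Z)).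
by rewrite addr0 (wred_reduced N_gt0 wave 1 0) addr0.
Qed.

End WaveCoefficients.

(** * Taylor coefficients of gamma *)

Section Gamma.
Variables (K : numFieldType) (N : nat) (s : K).
Hypothesis N_gt0 : (0 < N)%N.

(** The expansion begins [-1/a + x/2 - a x^2/12]. Because of the extra factor [x], the values
    [gamma_D] at 0 and 1 need exactly these three coefficients. *)
Lemma fps_x_div0 (a : K) : fps_x_div_1_sub_exp a 0 = - a^-1.
Proof.
by rewrite /fps_x_div_1_sub_exp /fps_inv1 big_ord_recl big_ord0 /= /fps_one eqxx addr0 mulr1.
Qed.

Lemma fps_x_div1 (a : K) : a != 0 -> fps_x_div_1_sub_exp a 1 = 1 / 2%:R.
Proof.
move=> a0; rewrite /fps_x_div_1_sub_exp /fps_inv1 !big_ord_recr big_ord0 /=.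
rewrite /fps_mul !big_ord_recr big_ord0 /= /fps_one /= !factS fact0.
by field; rewrite a0.
Qed.

Lemma fps_x_div2 (a : K) : a != 0 -> fps_x_div_1_sub_exp a 2 = - a / 12%:R.
Proof.
move=> a0; rewrite /fps_x_div_1_sub_exp /fps_inv1 !big_ord_recr big_ord0 /=.
rewrite /fps_mul !big_ord_recr !big_ord0 /= /fps_one /= !factS fact0.
by field; rewrite a0.
Qed.

Lemma gamma_D0 : gamma_D N s 0 = (1 - N%:R) / 2%:R - s.
Proof.
have Nn0 : N%:R != 0 :> K by rewrite pnatr_eq0 -lt0n.
rewrite /gamma_D /x_gamma_series !fps_x_div1 ?invr_neq0 ?oner_eq0 //.
rewrite /fps_mul !big_ord_recr big_ord0 /= !fps_x_div0 fps_x_div1 ?invr_neq0 //.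
by rewrite /fps_exp /fps_one /= !factS fact0; field.
Qed.

Lemma gamma_D1 : gamma_D N s 1
  = (N%:R ^+ 2 - 1) / (12%:R * N%:R) + s / (2%:R * N%:R) - s ^+ 2 / (2%:R * N%:R).
Proof.
have Nn0 : N%:R != 0 :> K by rewrite pnatr_eq0 -lt0n.
rewrite /gamma_D /x_gamma_series !fps_x_div2 ?invr_neq0 ?oner_eq0 //.
rewrite /fps_mul !big_ord_recr big_ord0 /= !fps_x_div0 fps_x_div1 ?fps_x_div2 ?invr_neq0 //.
by rewrite /fps_exp /fps_one /= !factS fact0; field.
Qed.

Lemma gamma0Xn n : gamma N s 0 'X^n = gamma_D N s n.
Proof.
rewrite /gamma ltxx eqxx size_polyXn big_ord_recr /= big1 ?add0r => [|i _].
  by rewrite coefXn eqxx mul1r.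
by rewrite coefXn (ltn_eqF (ltn_ord i)) mul0r.
Qed.

End Gamma.

(** * Symmetric polynomial dependence on the exponents *)

Section SymmetricQuantities.
Variables (K : numFieldType) (N : nat).
Hypothesis N_gt0 : (0 < N)%N.
Implicit Types (Q : ('I_N -> K) -> vect K -> K) (F : ('I_N -> K) -> vect K -> vect K).

(* Only actual wave functions are compared, so that their existence is never
   needed. *)
Definition symq Q := exists p : {mpoly K[N]}, p \is symmetric /\
  forall r Psi, is_bessel_wave r (bessel_s r) Psi -> Q r Psi = p.@[r].

Definition symv F := forall i, symq (fun r Psi => F r Psi i).

Lemma symq_ext Q Q' : (forall r Psi, is_bessel_wave r (bessel_s r) Psi -> Q r Psi = Q' r Psi) ->
  symq Q' -> symq Q.
Proof. by move=> h [p [sp hp]]; exists p; split=> // r Psi w; rewrite h // hp. Qed.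

Lemma symq_const (c : K) : symq (fun _ _ => c).
Proof.
exists c%:MP; split=> [|r Psi _]; last by rewrite mevalC.
by rewrite -[c%:MP]mulr1 mul_mpolyC rpredZ ?rpred1.
Qed.

Lemma symq_add Q Q' : symq Q -> symq Q' -> symq (fun r Psi => Q r Psi + Q' r Psi).
Proof.
move=> [p [sp hp]] [q [sq hq]]; exists (p + q); split; first exact: rpredD.
by move=> r Psi w; rewrite (hp _ _ w) (hq _ _ w) mevalD.
Qed.

Lemma symq_mul Q Q' : symq Q -> symq Q' -> symq (fun r Psi => Q r Psi * Q' r Psi).
Proof.
move=> [p [sp hp]] [q [sq hq]]; exists (p * q); split; first exact: rpredM.
by move=> r Psi w; rewrite (hp _ _ w) (hq _ _ w) mevalM.
Qed.

Lemma symq_opp Q : symq Q -> symq (fun r Psi => - Q r Psi).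
Proof.
move=> h; apply: symq_ext (symq_mul (symq_const (-1)) h) => r Psi _.
by rewrite mulN1r.
Qed.

Lemma symq_sub Q Q' : symq Q -> symq Q' -> symq (fun r Psi => Q r Psi - Q' r Psi).
Proof. by move=> h1 h2; apply: symq_add => //; apply: symq_opp. Qed.

Lemma symq_exp Q n : symq Q -> symq (fun r Psi => Q r Psi ^+ n).
Proof.
move=> h; elim: n => [|n IH]; first exact: symq_const.
by apply: symq_ext (symq_mul h IH) => r Psi _; rewrite exprS.
Qed.

Lemma symq_sum n (Q : 'I_n -> ('I_N -> K) -> vect K -> K) :
  (forall i, symq (Q i)) -> symq (fun r Psi => \sum_(i < n) Q i r Psi).
Proof.
elim: n Q => [|n IH] Q h.
  by apply: symq_ext (symq_const 0) => r Psi _; rewrite big_ord0.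
apply: symq_ext (symq_add (h ord0) (IH _ (fun i => h (lift ord0 i)))) => r Psi _.
by rewrite big_ord_recl.
Qed.

Definition generic_poly : {poly {mpoly K[N]}} := \prod_(i < N) ('X - ('X_i)%:P).

(** Permuting the variables permutes the factors of [generic_poly], so its coefficients are
    symmetric; evaluation at [r] gives [bessel_poly r]. *)
Lemma symq_coef l : symq (fun r _ => (bessel_poly r)`_l).
Proof.
exists generic_poly`_l; split; last first.
  move=> r Psi _; suff -> : bessel_poly r = map_poly (meval r) generic_poly.
    by rewrite coef_map.
  rewrite /generic_poly rmorph_prod; apply: eq_bigr => i _.
  by rewrite rmorphB /= map_polyX map_polyC /= mevalXU.
apply/issymP => sg.
suff {2}-> : generic_poly = map_poly (msym sg) generic_poly by rewrite coef_map.
rewrite /generic_poly rmorph_prod [LHS](reindex_inj (@perm_inj _ sg)) /=.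
apply: eq_bigr => i _; rewrite rmorphB /= map_polyX map_polyC /=.
by rewrite /msym mmapX mmap1U.
Qed.

Lemma symq_s : symq (fun r _ => bessel_s r).
Proof.
apply: symq_sub; last exact: symq_const.
exists (\sum_i 'X_i); split; last first.
  by move=> r Psi _; rewrite raddf_sum; apply: eq_bigr => i _; rewrite /= mevalXU.
apply/issymP => sg; rewrite raddf_sum [RHS](reindex_inj (@perm_inj _ sg)) /=.
by apply: eq_bigr => i _; rewrite /msym mmapX mmap1U.
Qed.

Lemma symv_Dact F : symv F -> symv (fun r Psi => Dact N (bessel_s r) (F r Psi)).
Proof.
move=> h i; apply: symq_add; first exact: h.
apply: symq_mul => //; apply: symq_mul; last exact: symq_const.
by apply: symq_sub; [exact: symq_s | exact: symq_const].
Qed.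

Lemma symv_iter n F : symv F -> symv (fun r Psi => iter n (Dact N (bessel_s r)) (F r Psi)).
Proof. by move=> h; elim: n => //= n IH; apply: symv_Dact. Qed.

Lemma symv_pD n (P : ('I_N -> K) -> {poly K}) F :
  (forall r, size (P r) <= n)%N -> (forall l, symq (fun r _ => (P r)`_l)) -> symv F ->
  symv (fun r Psi => pD N (bessel_s r) (P r) (F r Psi)).
Proof.
move=> hn hP hF i.
apply: (@symq_ext _ (fun r Psi =>
  \sum_(l < n) (P r)`_l * iter l (Dact N (bessel_s r)) (F r Psi) i)).
  by move=> r Psi _; rewrite (pD_widen _ _ _ (hn r)) fct_sumE.
by apply: symq_sum => l; apply: symq_mul => //; apply: symv_iter.
Qed.

Lemma symv_Xn n F : symv F -> symv (fun r Psi => pD N (bessel_s r) 'X^n (F r Psi)).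
Proof.
by move=> h; apply: (@symv_pD n.+1) => // [r|l]; [rewrite size_polyXn | exact: symq_const].
Qed.

Lemma symq_wave (y : int) : symq (fun _ Psi => Psi y).
Proof.
have [hy|hy] := ltP y 0.
  by apply: symq_ext (symq_const 0) => r Psi [_ h _]; apply: h.
have -> : y = (absz y)%:Z by lia.
elim: {y hy}(absz y) {-2}(absz y) (leqnn (absz y)) => [|n IH] m hm.
  have -> : m = 0%N by lia.
  by apply: symq_ext (symq_const 1) => r Psi [h _ _].
have [m0|m_gt0] := posnP m.
  by rewrite m0; apply: symq_ext (symq_const 1) => r Psi [h _ _].
(* The recursion divides only by the nonzero integer [m], so it stays polynomial in [r]. *)
apply: (@symq_ext _ (fun r Psi => (m%:R)^-1 *
   pD N (bessel_s r) (bessel_poly r) (fun i => if i < m%:Z then Psi i else 0) (m%:Z + 1 - N%:Z))).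
  move=> r Psi w; rewrite -(wave_recursion N_gt0 w) mulrA mulVf ?mul1r //.
  by rewrite pnatr_eq0 -lt0n.
apply: symq_mul; first exact: symq_const.
apply: (@symv_pD N.+1) => [r|l|i]; last 1 first.
- have [hi|hi] := ltP i m%:Z; last exact: symq_const.
  have [hi0|hi0] := ltP i 0.
    by apply: symq_ext (symq_const 0) => r Psi [_ h _]; apply: h.
  have -> : i = (absz i)%:Z by lia.
  by apply: IH; lia.
- by rewrite size_bessel_poly.
exact: symq_coef.
Qed.

Lemma symv_wred k : symv (fun r Psi => wred N (bessel_s r) Psi k).
Proof.
elim: k => [|k IH] i /=; first exact: symq_wave.
apply: symq_sub; last by apply: symq_mul; [exact: IH | exact: symq_wave].
apply: symq_sub; first exact: symv_Dact.
apply: symq_mul; last exact: IH.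
apply: symq_mul; last exact: symq_const.
by apply: symq_add; [exact: symq_s | exact: symq_const].
Qed.

Lemma symq_gamma_D l : symq (fun r _ => gamma_D N (bessel_s r) l).
Proof.
apply: symq_mul; first exact: symq_const.
apply: symq_add; first exact: symq_const.
apply: symq_sum => i; apply: symq_mul; last exact: symq_const.
apply: symq_sub; last exact: symq_const.
apply: symq_mul; last exact: symq_const.
apply: symq_exp; apply: symq_mul; last exact: symq_const.
exact: symq_s.
Qed.

(** The sign comes from [L^l_0 = W(- D^l)]. *)
Definition weight (r : 'I_N -> K) Psi l : K :=
  - (eigen N (bessel_s r) Psi 0 'X^l + gamma N (bessel_s r) 0 'X^l).

Lemma symq_weight l : symq (fun r Psi => weight r Psi l).
Proof.
apply: symq_opp; apply: symq_add; last first.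
  by apply: symq_ext (symq_gamma_D l) => r Psi _; apply: gamma0Xn.
apply: symq_sum => i; apply: symq_sub.
  have := @symv_Xn l _ (symv_wred i) (- i%:Z).
  by apply: symq_ext => r Psi _; rewrite diffopE zact0.
have := @symv_Xn l _ (fun j => symq_const (vdelta K (- i%:Z) j)) (- i%:Z).
by apply: symq_ext => r Psi _; rewrite /diffop_mx diffopE zact0.
Qed.

Lemma weight0 r Psi : is_bessel_wave r (bessel_s r) Psi ->
  weight r Psi 0 = \sum_(i < N) r i.
Proof.
move=> w; rewrite /weight gamma0Xn gamma_D0 // expr0 (eigen_one N_gt0 w) /bessel_s.
by field.
Qed.

(** With [s] expressed through the sum of the [r i], the square of that sum cancels between [Psi 1]
    and [gamma_D], which leaves the two power sums. *)
Lemma weight1 r Psi : is_bessel_wave r (bessel_s r) Psi ->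
  weight r Psi 1 = 1 / 2%:R * \sum_(i < N) r i ^+ 2 - 1 / 2%:R * \sum_(i < N) r i.
Proof.
have Nn0 : N%:R != 0 :> K by rewrite pnatr_eq0 -lt0n.
move=> w; rewrite /weight gamma0Xn gamma_D1 // expr1 (eigen_X N_gt0 w).
by rewrite (wave_first N_gt0 w) /bessel_s; field.
Qed.

(** The polynomials of [symq_weight] are tied to the weights only through wave functions, whereas
    the formulas for [l = 0] and [l = 1] are asserted at every [r]; [lambda] is therefore defined by
    these formulas in the first two cases. *)
Lemma weight_exists : exists lambda : ('I_N -> K) -> nat -> K,
  [/\ forall l, exists p : {mpoly K[N]},
        p \is symmetric /\ forall r, lambda r l = p.@[r],
      forall r, lambda r 0%N = \sum_(i < N) r i,
      forall r, lambda r 1%N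
        = 1 / 2%:R * \sum_(i < N) r i ^+ 2 - 1 / 2%:R * \sum_(i < N) r i &
      forall r Psi l, is_bessel_wave r (bessel_s r) Psi -> weight r Psi l = lambda r l].
Proof.
have hsum n : exists p : {mpoly K[N]}, p \is symmetric /\
    forall r, \sum_(i < N) r i ^+ n = p.@[r].
  exists (\sum_i 'X_i ^+ n); split.
    apply/issymP => sg; rewrite raddf_sum [RHS](reindex_inj (@perm_inj _ sg)) /=.
    by apply: eq_bigr => i _; rewrite /= rmorphXn /= /msym mmapX mmap1U.
  by move=> r; rewrite raddf_sum; apply: eq_bigr => i _; rewrite /= rmorphXn /= mevalXU.
have [p1 [s1 h1]] := hsum 1%N; have [p2 [s2 h2]] := hsum 2%N.
have /choice [p hp] := fun l => symq_weight l.
exists (fun r l => match l with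
  | 0 => \sum_(i < N) r i
  | 1 => 1 / 2%:R * \sum_(i < N) r i ^+ 2 - 1 / 2%:R * \sum_(i < N) r i
  | l => (p l).@[r] end); split=> //.
- case=> [|[|l]]; last by exists (p l.+2); split=> //; case: (hp l.+2).
    by exists p1; split=> // r; rewrite -h1.
  exists ((1 / 2%:R) *: p2 - (1 / 2%:R) *: p1); split.
    by rewrite rpredB ?rpredZ.
  by move=> r; rewrite mevalB !mevalZ -h1 -h2.
- move=> r Psi [|[|l]] w; [exact: weight0 | exact: weight1 | exact: (hp l.+2).2].
Qed.

End SymmetricQuantities.

Theorem theorem2 (R : realType) (N : nat) (hN : (1 <= N)%N)
    (sigma : fock R[i] -> tseries R[i]) (sigma' : tseries R[i] -> fock R[i])
    (hsigma : boson_fermion sigma sigma') :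
  exists lambda : ('I_N -> R[i]) -> nat -> R[i],
    [/\ forall l : nat, exists p : {mpoly R[i][N]},
          p \is symmetric /\ forall r : 'I_N -> R[i], lambda r l = p.@[r],
        forall r : 'I_N -> R[i], lambda r 0%N = \sum_(i < N) r i,
        forall r : 'I_N -> R[i],
          lambda r 1%N
          = 1 / 2%:R * \sum_(i < N) r i ^+ 2 - 1 / 2%:R * \sum_(i < N) r i &
        forall (r : 'I_N -> R[i]) (s : R[i]) (tau : tseries R[i]),
          bessel_s r = s -> is_tau r sigma tau ->
          [/\ forall (l : nat) (k : int), 0 < k ->
                Lop N s sigma sigma' l k tau = 0,
              forall l : nat,
                Lop N s sigma sigma' l 0 tau = lambda r l *: tau,
              quasifinite N s sigma sigma' tau,
              forall k : nat, (1 <= k)%N ->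
                W N s sigma sigma' (- k%:Z) (wchar_poly r k) tau = 0 &
              forall (k : nat) (b : {poly R[i]}), (1 <= k)%N -> b != 0 ->
                W N s sigma sigma' (- k%:Z) b tau = 0 ->
                (size (wchar_poly r k) <= size b)%N]].
Proof.
have [[lin sK sK'] _] := hsigma.
have [lambda [hl h0 h1 hw]] := weight_exists R[i] hN; exists lambda; split=> //.
move=> r s tau <- [Psi [w [wave adm ->]]] {s tau}.
rewrite (wedge_admissible hN wave adm).
set s := bessel_s r; pose tau := sigma (wedge (wred N s Psi)); rewrite -/tau.
have Wtau k p : W N s sigma sigma' k p tau = sigma (W_fock N s k p (wedge (wred N s Psi))).
  by rewrite /W sK.
have s0 : sigma 0 = 0 by have := sigmaZ lin 0 0; rewrite !scale0r.
have Wann k p : k != 0 -> stabilizes N s Psi k p -> W N s sigma sigma' k p tau = 0.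
  by move=> k0 st; rewrite Wtau (W_fock_stable0 hN wave k0 st).
have stn k p : 0 <= k -> stabilizes N s Psi k p.
  by case: k => // n _; apply: (stabilizes_nat hN wave).
have annP n p : (0 < n)%N -> W N s sigma sigma' (- n%:Z) (wchar_poly r n * p) tau = 0.
  move=> hn; apply: Wann; first by lia.
  exact: (stabilizes_wchar hN wave).
split.
- by move=> l k hk; apply: Wann; [rewrite gt_eqF | apply/stn/ltW].
- move=> l; rewrite -(hw r Psi l wave) /weight -/s.
  rewrite /Lop Wtau W_fockN (W_fock_stable hN wave (stn 0 _ (lexx 0))) -scaleNr.
  by rewrite sigmaZ.
- apply: (@quasifinite_tau _ _ _ _ _ hN lin sK sK' _ (wchar_poly r)) => //.
  + move=> k p hk; exists (eigen N s Psi k p + gamma N s k p).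
    by rewrite Wtau (W_fock_stable hN wave (stn _ _ hk)) sigmaZ.
  + by move=> n; rewrite -size_poly_gt0 size_wchar_poly.
- by move=> k hk; have := annP k 1 hk; rewrite mulr1.
- move=> k b hk b0; rewrite Wtau -[X in _ = X -> _]s0 => /(can_inj sK) h.
  exact: (wchar_poly_min hN wave hk b0 h).
Qed.
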